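(* Let $a,b,c,d\in\mathbb R$ satisfy $a^2+c^2>0$ and $\Delta:=ad-bc\neq 0$, and let $\kappa(s)=cs+d$, $\tau(s)=as+b$ for $s\in\mathbb R$. With $\rho,\chi,\xi(s),\xi_0,\zeta,U,V,\mathcal F_\chi,\mathcal G_\chi$ as defined in the context, the three-dimensional clothoid with signed curvature $\kappa$ and torsion $\tau$ is, up to an orientation-preserving rigid motion of $\mathbb R^3$, the curve $r(s)=(x(s),y(s),z(s))$, $s\in\mathbb R$, given by $$x(s)+\mathrm i\,y(s)=\rho^{-3/2}\Big[\,2c\,\xi\,\mathcal F_\chi+e^{-\zeta}\Big\{a\chi U^2+\frac{a\chi^3\xi^2}{4}V^2-(c\,\xi+\mathrm i a\chi\xi^2)\,UV\Big\}\Big]_{\xi_0}^{\xi(s)},$$ $$z(s)=\rho^{-3/2}\Big[\operatorname{Re}\Big(\frac{\mathrm i c\chi\xi^2}{2}\mathcal G_\chi\Big)+a\,\xi\big\{2|U|^2-1-\chi^2\operatorname{Im}(\overline U\,V)\big\}\Big]_{\xi_0}^{\xi(s)}.$$ Here every function inside the brackets is evaluated at the real variable $\xi$, and $[f]_{\xi_0}^{\xi(s)}=f(\xi(s))-f(\xi_0)$.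
   Context: A three-dimensional clothoid with signed curvature $\kappa(s)=cs+d$ and torsion $\tau(s)=as+b$ is a smooth unit-speed curve $\tilde r:\mathbb R\to\mathbb R^3$ (parameter $s$ = arclength) that admits a smooth positively oriented orthonormal frame $(T,N,B)$ along it with $\tilde r'=T$ and satisfying the (smoothly continued) Frenet equations $T'=\kappa N$, $N'=-\kappa T+\tau B$, $B'=-\tau N$ for all $s$. Here $\kappa$ may change sign; away from its zeros the ordinary curvature is $|cs+d|$. Notation: $\Delta=ad-bc$, $\rho=\sqrt{a^2+c^2}$, $\chi=-\Delta/\rho^{3/2}$, $\xi(s)=\sqrt\rho\left(s+\frac{ab+cd}{\rho^2}\right)$, $\xi_0=\xi(0)$. For real $\xi$: $\mu=\frac12+\frac{\mathrm i\chi^2}{8}$, $\zeta=\zeta(\xi)=\frac{\mathrm i\xi^2}{2}$, $U(\xi)={}_1F_1(\mu;\tfrac12;\zeta)$, $V(\xi)={}_1F_1(\mu;\tfrac32;\zeta)$, where ${}_1F_1$ is Kummer's confluent hypergeometric function. Kampé de Fériet function: $$F_{1:1;1}^{1:1;1}\left[\begin{matrix}A:B;C\\ D:E;F\end{matrix};X,Y\right]=\sum_{j,k\ge0}\frac{(A)_{j+k}(B)_j(C)_k}{(D)_{j+k}(E)_j(F)_k}\frac{X^jY^k}{j!\,k!},$$ with $(\cdot)_n$ the Pochhammer symbol (rising factorial). Define $$\mathcal F_\chi(\xi)=F_{1:1;1}^{1:1;1}\left[\begin{matrix}\frac12:\mu;\frac12-\mu\\ \frac32:\frac12;\frac12\end{matrix};\zeta,-\zeta\right],\qquad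 \mathcal G_\chi(\xi)=F_{1:1;1}^{1:1;1}\left[\begin{matrix}1:\mu;1-\mu\\ 2:\frac32;\frac12\end{matrix};\zeta,-\zeta\right].$$ *)

(* Defs.v *)
From Stdlib Require Import Reals Factorial.
From Coquelicot Require Import Coquelicot.

Open Scope R_scope.

Definition R3 : Type := (R * R * R)%type.

Definition px (v : R3) : R := fst (fst v).
Definition py (v : R3) : R := snd (fst v).
Definition pz (v : R3) : R := snd v.

Definition dot (u v : R3) : R := px u * px v + py u * py v + pz u * pz v.

Definition det3 (u v w : R3) : R :=
  px u * (py v * pz w - pz v * py w)
  - py u * (px v * pz w - pz v * px w)
  + pz u * (px v * py w - py v * px w).

Definition positive_orthonormal (u v w : R3) : Prop :=
  (dot u u = 1 /\ dot v v = 1 /\ dot w w = 1) /\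
  (dot u v = 0 /\ dot u w = 0 /\ dot v w = 0) /\
  0 < det3 u v w.

Definition smooth (f : R -> R) : Prop := forall (n : nat) (s : R), ex_derive_n f n s.

Definition smooth3 (f : R -> R3) : Prop :=
  smooth (fun s => px (f s)) /\ smooth (fun s => py (f s)) /\ smooth (fun s => pz (f s)).

(* The signed curvature [kappa] may vanish and change sign. Unit speed is
   [r' = T] together with [dot T T = 1]. *)
Definition signed_frenet_curve (kappa tau : R -> R) (r : R -> R3) : Prop :=
  smooth3 r /\
  exists T N B : R -> R3,
    (smooth3 T /\ smooth3 N /\ smooth3 B) /\
    forall s : R,
      positive_orthonormal (T s) (N s) (B s) /\
      is_derive r s (T s) /\
      is_derive T s (scal (kappa s) (N s)) /\
      is_derive N s (plus (scal (- kappa s) (T s)) (scal (tau s) (B s))) /\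
      is_derive B s (scal (- tau s) (N s)).

Definition clothoid (a b c d : R) : (R -> R3) -> Prop :=
  signed_frenet_curve (fun s => c * s + d) (fun s => a * s + b).

(* [u], [v], [w] are the columns of the rotation matrix, [p] the translation. *)
Definition rigid_motion (g : R3 -> R3) : Prop :=
  exists p u v w : R3,
    positive_orthonormal u v w /\
    forall x : R3,
      g x = plus p (plus (scal (px x) u) (plus (scal (py x) v) (scal (pz x) w))).

Open Scope C_scope.

Definition Cexp (z : C) : C := RtoC (exp (Re z)) * (cos (Im z), sin (Im z)).

Definition CSeries (u : nat -> C) : C :=
  (Series (fun n => Re (u n)), Series (fun n => Im (u n))).

Fixpoint pochhammer (x : C) (n : nat) : C :=
  match n with
  | O => 1
  | S m => pochhammer x m * (x + INR m)
  end.

Definition hyp1F1 (a b z : C) : C :=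
  CSeries (fun n => pochhammer a n / pochhammer b n * (z ^ n / INR (fact n))).

(* F^{1:1;1}_{1:1;1}[A:B;C / D:E;F; X,Y]. When no lower parameter is a
   nonpositive integer, the double series converges absolutely for all X, Y,
   so the order of summation is immaterial. *)
Definition kampe_de_feriet (pA pB pC pD pE pF X Y : C) : C :=
  CSeries (fun j => CSeries (fun k =>
    (pochhammer pA (j + k) * pochhammer pB j * pochhammer pC k)
    / (pochhammer pD (j + k) * pochhammer pE j * pochhammer pF k)
    * (X ^ j * Y ^ k / (INR (fact j) * INR (fact k))))).

Definition Delta_abcd (a b c d : R) : R := (a * d - b * c)%R.

Definition rho (a c : R) : R := sqrt (a ^ 2 + c ^ 2).

Definition chi (a b c d : R) : R := (- Delta_abcd a b c d / Rpower (rho a c) (3 / 2))%R.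

Definition xi (a b c d s : R) : R :=
  (sqrt (rho a c) * (s + (a * b + c * d) / rho a c ^ 2))%R.

Definition mu (chi : R) : C := 1 / 2 + Ci * chi ^ 2 / 8.

Definition zeta (xi : R) : C := Ci * xi ^ 2 / 2.

Definition U (chi xi : R) : C := hyp1F1 (mu chi) (1 / 2) (zeta xi).

Definition V (chi xi : R) : C := hyp1F1 (mu chi) (3 / 2) (zeta xi).

Definition calF (chi xi : R) : C :=
  kampe_de_feriet (1 / 2) (mu chi) (1 / 2 - mu chi)
                  (3 / 2) (1 / 2) (1 / 2) (zeta xi) (- zeta xi).

Definition calG (chi xi : R) : C :=
  kampe_de_feriet 1 (mu chi) (1 - mu chi)
                  2 (3 / 2) (1 / 2) (zeta xi) (- zeta xi).

(* Main.v *)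
(* The Darboux vector tau T + kappa B is affine in s, so rotating (T, B) by a
   constant angle and rescaling s to xi gives an orthonormal frame (A, N, C) with
     A' = - chi N,  N' = chi A + xi C,  C' = - xi N,   rho T = a A - c C.
   Its spin lift is a two-component linear system solved by U and v = xi V, namely
     U' = i xi U - (chi^2 / 4) v,   v' = U,
   whose conserved quantity |U|^2 + (chi^2 / 4) |v|^2 = 1 makes the frame
   orthonormal.  The curve is the integral of T: the integral of A is
   xi A - chi C, and the integral of C leads to the Kampe de Feriet functions,
   since d(xi F)/dxi = e^(-zeta) U^2 (through Kummer's transformation) and
   d(xi^2 G)/dxi = 2 v conj(U).  Uniqueness up to rigid motion is uniqueness for
   the skew-symmetric Frenet system. *)

Require Import Defs.
From Stdlib Require Import Reals Factorial Lra Lia.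
From Coquelicot Require Import Coquelicot.

Open Scope R_scope.

(** * Complex-valued functions of a real variable *)

(** Only real calculus is used. Along the curve [zeta] is the fixed number [half_i] times the real
    number [x ^ 2], so each Kummer function is a power series in a real variable with complex
    coefficients, and its differential equation is a recurrence between coefficients. Two obstacles
    shape the analysis. The Kampe de Feriet functions are iterated sums; but the Pochhammer symbols
    carrying n = j + k have ratio 1/(2n+1) or 1/(n+1), so up to a power of the variable these
    functions are primitives of a product of two single series, and no double series is rearranged.
    In [calF] one of the two factors has parameter 1/2 - mu and argument -zeta; its link with [U] is
    Kummer's transformation, obtained here from uniqueness for a linear system and not by
    multiplying series. On the geometric side the Frenet coefficients are scalars, so every space
    coordinate of (T, N, B) solves the same linear system of three scalar equations. Smoothness,
    rotations and uniqueness are therefore treated one coordinate at a time. *)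

Definition is_Cderive (f : R -> C) (x : R) (l : C) : Prop :=
  is_derive (fun t => Re (f t)) x (Re l) /\ is_derive (fun t => Im (f t)) x (Im l).

Lemma is_Cderive_eq (f : R -> C) (x : R) (l m : C) :
  is_Cderive f x l -> l = m -> is_Cderive f x m.
Proof. intros H E; now rewrite <- E. Qed.

Lemma is_Cderive_ext (f g : R -> C) (x : R) (l : C) :
  (forall t, f t = g t) -> is_Cderive f x l -> is_Cderive g x l.
Proof.
  intros E [H1 H2]; split.
  - apply (is_derive_ext (fun t => Re (f t))); [intros t; now rewrite E | exact H1].
  - apply (is_derive_ext (fun t => Im (f t))); [intros t; now rewrite E | exact H2].
Qed.

Lemma is_Cderive_const (z : C) (x : R) : is_Cderive (fun _ => z) x 0%C.
Proof. split; apply @is_derive_const. Qed.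

Lemma is_Cderive_id (x : R) : is_Cderive (fun t => RtoC t) x 1%C.
Proof. split; simpl; [apply @is_derive_id | apply @is_derive_const]. Qed.

Lemma is_Cderive_plus (f g : R -> C) (x : R) (l m : C) :
  is_Cderive f x l -> is_Cderive g x m -> is_Cderive (fun t => f t + g t)%C x (l + m)%C.
Proof.
  intros [F1 F2] [G1 G2]; split.
  - exact (is_derive_plus _ _ _ _ _ F1 G1).
  - exact (is_derive_plus _ _ _ _ _ F2 G2).
Qed.

Lemma is_Cderive_opp (f : R -> C) (x : R) (l : C) :
  is_Cderive f x l -> is_Cderive (fun t => - f t)%C x (- l)%C.
Proof.
  intros [F1 F2]; split.
  - exact (is_derive_opp _ _ _ F1).
  - exact (is_derive_opp _ _ _ F2).
Qed.

Lemma is_Cderive_minus (f g : R -> C) (x : R) (l m : C) :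
  is_Cderive f x l -> is_Cderive g x m -> is_Cderive (fun t => f t - g t)%C x (l - m)%C.
Proof. intros F G; apply is_Cderive_plus; [exact F | now apply is_Cderive_opp]. Qed.

Lemma is_Cderive_mult (f g : R -> C) (x : R) (l m : C) :
  is_Cderive f x l -> is_Cderive g x m ->
  is_Cderive (fun t => f t * g t)%C x (l * g x + f x * m)%C.
Proof.
  intros [F1 F2] [G1 G2].
  pose proof (fun u v du dv (Hu : is_derive u x du) (Hv : is_derive v x dv) =>
    @is_derive_mult R_AbsRing u v x du dv Hu Hv Rmult_comm) as M.
  split.
  - apply (is_derive_ext (fun t => Re (f t) * Re (g t) - Im (f t) * Im (g t)));
      [intros t; now rewrite re_mult|].
    evar_last.
    + exact (is_derive_minus _ _ _ _ _ (M _ _ _ _ F1 G1) (M _ _ _ _ F2 G2)).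
    + rewrite re_plus, !re_mult; unfold minus, plus, opp, mult; simpl; ring.
  - apply (is_derive_ext (fun t => Re (f t) * Im (g t) + Im (f t) * Re (g t)));
      [intros t; now rewrite im_mult|].
    evar_last.
    + exact (is_derive_plus _ _ _ _ _ (M _ _ _ _ F1 G2) (M _ _ _ _ F2 G1)).
    + rewrite im_plus, !im_mult; unfold plus, mult; simpl; ring.
Qed.

Lemma is_Cderive_scal (z : C) (f : R -> C) (x : R) (l : C) :
  is_Cderive f x l -> is_Cderive (fun t => z * f t)%C x (z * l)%C.
Proof.
  intros F; apply (is_Cderive_eq _ _ _ _ (is_Cderive_mult _ _ _ _ _ (is_Cderive_const z x) F)).
  ring.
Qed.

Lemma is_Cderive_conj (f : R -> C) (x : R) (l : C) :
  is_Cderive f x l -> is_Cderive (fun t => Cconj (f t)) x (Cconj l).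
Proof. intros [F1 F2]; split; [exact F1 | exact (is_derive_opp _ _ _ F2)]. Qed.

Lemma is_Cderive_pow (n : nat) (x : R) :
  is_Cderive (fun t => RtoC t ^ S n)%C x (RtoC (INR (S n)) * RtoC x ^ n)%C.
Proof.
  induction n as [|n IH].
  - apply (is_Cderive_ext (fun t => RtoC t)); [intros t; simpl; ring|].
    apply (is_Cderive_eq _ _ _ _ (is_Cderive_id x)); simpl; ring.
  - apply (is_Cderive_eq _ _ _ _ (is_Cderive_mult _ _ _ _ _ (is_Cderive_id x) IH)).
    rewrite (S_INR (S n)), RtoC_plus; simpl Cpow; ring.
Qed.

(** The chain rule in the only form that the Kummer series require, as they are series in
    [x ^ 2]. *)
Lemma is_Cderive_comp_sqr (f : R -> C) (x : R) (l : C) :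
  is_Cderive f (x ^ 2) l -> is_Cderive (fun t => f (t ^ 2)) x (2 * x * l)%C.
Proof.
  intros [F1 F2].
  assert (D : is_derive (fun t : R => t ^ 2) x (2 * x)) by (auto_derive; [trivial|ring]).
  split.
  - evar_last; [exact (is_derive_comp (fun t => Re (f t)) _ _ _ _ F1 D)|].
    rewrite <- RtoC_mult, re_scal_l; reflexivity.
  - evar_last; [exact (is_derive_comp (fun t => Im (f t)) _ _ _ _ F2 D)|].
    rewrite <- RtoC_mult, im_scal_l; reflexivity.
Qed.

Lemma Cmod_le_abs (z : C) : Cmod z <= Rabs (Re z) + Rabs (Im z).
Proof.
  destruct z as [u v]; unfold Cmod, Re, Im; simpl fst; simpl snd.
  apply Rsqr_incr_0_var; [|generalize (Rabs_pos u), (Rabs_pos v); lra].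
  rewrite Rsqr_sqrt by nra.
  rewrite <- (pow2_abs u), <- (pow2_abs v); unfold Rsqr.
  generalize (Rabs_pos u), (Rabs_pos v); nra.
Qed.

Lemma abs_Im_le_Cmod (z : C) : Rabs (Im z) <= Cmod z.
Proof. generalize (Rmax_Cmod z), (Rmax_r (Rabs (fst z)) (Rabs (snd z))); unfold Im; lra. Qed.

(** The mean value inequality is applied to the real and imaginary parts separately; adding the two
    bounds costs the harmless factor 2. *)
Lemma Cmean_value (f df : R -> C) (M x : R) :
  (forall t, Rabs t <= Rabs x -> is_Cderive f t (df t) /\ Cmod (df t) <= M) ->
  Cmod (f x - f 0)%C <= 2 * (M * Rabs x).
Proof.
  intros H.
  assert (B : forall h : C -> R, (forall z, Rabs (h z) <= Cmod z) ->
    (forall t, Rabs t <= Rabs x -> is_derive (fun t => h (f t)) t (h (df t))) ->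
    Rabs (h (f x) - h (f 0)) <= M * Rabs x).
  { intros h Hh Hd.
    replace (Rabs x) with (Rabs (x - 0)) by (f_equal; ring).
    apply (bounded_variation (fun t => h (f t)) (fun t => h (df t))).
    intros t; rewrite !Rminus_0_r; intros Ht; split; [now apply Hd|].
    apply Rle_trans with (Cmod (df t)); [apply Hh | now apply H]. }
  apply Rle_trans with (1 := Cmod_le_abs _).
  unfold Cminus; rewrite re_plus, im_plus, re_opp, im_opp.
  assert (B1 := B Re re_le_Cmod (fun t Ht => proj1 (proj1 (H t Ht)))).
  assert (B2 := B Im abs_Im_le_Cmod (fun t Ht => proj2 (proj1 (H t Ht)))).
  apply Rle_trans with (1 := Rplus_le_compat _ _ _ _ B1 B2); lra.
Qed.

(** * Power series in a real variable with complex coefficients *)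

Definition CPSeries (a : nat -> C) (x : R) : C :=
  (PSeries (fun n => Re (a n)) x, PSeries (fun n => Im (a n)) x).

Definition entire (a : nat -> C) : Prop :=
  forall r, 0 <= r -> ex_series (fun n => Cmod (a n) * r ^ n).

Lemma entire_le (a b : nat -> C) :
  (forall n, Cmod (a n) <= Cmod (b n)) -> entire b -> entire a.
Proof.
  intros H Hb r Hr.
  apply (@ex_series_le R_AbsRing R_CompleteNormedModule _ (fun n => Cmod (b n) * r ^ n));
    [|now apply Hb].
  intros n; unfold norm; simpl; unfold abs; simpl.
  rewrite Rabs_pos_eq by (apply Rmult_le_pos; [apply Cmod_ge_0 | now apply pow_le]).
  apply Rmult_le_compat_r; [now apply pow_le | apply H].
Qed.

(** By induction |a_n| is at most |a_0| |K|^n / n!, so an exponential series dominates at every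
    radius. *)
Lemma entire_ratio (a : nat -> C) (K : R) :
  (forall n, Cmod (a (S n)) * INR (S n) <= K * Cmod (a n)) -> entire a.
Proof.
  intros H r Hr.
  assert (K0 : 0 <= Rabs K) by apply Rabs_pos.
  assert (B : forall n, Cmod (a n) <= Cmod (a 0%nat) * (Rabs K ^ n * / INR (fact n))).
  { induction n as [|n IH]; [simpl; lra|].
    assert (P : 0 < INR (S n)) by (apply lt_0_INR; lia).
    assert (P' : 0 < INR (fact n)) by apply INR_fact_lt_0.
    apply Rmult_le_reg_r with (1 := P).
    apply Rle_trans with (1 := H n).
    apply Rle_trans with (Rabs K * Cmod (a n)).
    { apply Rmult_le_compat_r; [apply Cmod_ge_0 | apply Rle_abs]. }
    apply Rle_trans with (1 := Rmult_le_compat_l _ _ _ K0 IH).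
    right; rewrite fact_simpl, mult_INR; simpl pow; field; lra. }
  apply (@ex_series_le R_AbsRing R_CompleteNormedModule _
    (fun n => Cmod (a 0%nat) * (/ INR (fact n) * (Rabs K * r) ^ n))).
  - intros n; unfold norm; simpl; unfold abs; simpl.
    rewrite Rabs_pos_eq by (apply Rmult_le_pos; [apply Cmod_ge_0 | now apply pow_le]).
    rewrite Rpow_mult_distr.
    apply Rle_trans with (1 := Rmult_le_compat_r _ _ _ (pow_le r n Hr) (B n)); right; ring.
  - apply (@ex_series_scal_l R_AbsRing), ex_pseries_R.
    eexists; apply is_exp_Reals.
Qed.

(** Convergence at r makes the terms bounded there, so r does not exceed the radius of convergence.
    Here [h] stands for [Re] or [Im]. *)
Lemma entire_PSeries (a : nat -> C) (h : C -> R) :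
  (forall z, Rabs (h z) <= Cmod z) -> entire a ->
  CV_radius (fun n => h (a n)) = p_infty.
Proof.
  intros Hh Ha.
  destruct (CV_radius_bounded (fun n => h (a n))) as [Hub _].
  assert (L : forall r, 0 <= r -> Rbar_le r (CV_radius (fun n => h (a n)))).
  { intros r Hr; apply Hub.
    destruct (Ha r Hr) as [S HS].
    assert (Z : is_lim_seq (fun n => Cmod (a n) * r ^ n) 0)
      by (apply ex_series_lim_0; now exists S).
    destruct (filterlim_bounded (fun n => Cmod (a n) * r ^ n)) as [M HM].
    { exists 0; exact Z. }
    exists M; intros n.
    apply Rle_trans with (2 := HM n).
    unfold norm; simpl; unfold abs; simpl.
    rewrite !Rabs_mult; apply Rmult_le_compat_r; [apply Rabs_pos|].
    rewrite (Rabs_pos_eq (Cmod _)) by apply Cmod_ge_0; apply Hh. }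
  destruct (CV_radius (fun n => h (a n))) as [r| |] eqn:E; [|reflexivity|].
  - generalize (L (Rabs r + 1)%R); simpl.
    generalize (Rle_abs r), (Rabs_pos r); intros; exfalso.
    assert (Rabs r + 1 <= r) by (apply H1; lra); lra.
  - destruct (L 0); lra.
Qed.

Definition Cderiv_coef (a : nat -> C) (n : nat) : C := (INR (S n) * a (S n))%C.

Lemma is_Cderive_CPSeries (a : nat -> C) (x : R) :
  entire a -> is_Cderive (CPSeries a) x (CPSeries (Cderiv_coef a) x).
Proof.
  intros Ha; split; unfold CPSeries; cbn [Re Im fst snd].
  - evar_last; [apply is_derive_PSeries; rewrite (entire_PSeries a Re re_le_Cmod Ha); exact I|].
    apply PSeries_ext; intros n; unfold Cderiv_coef, PS_derive; now rewrite re_scal_l.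
  - evar_last; [apply is_derive_PSeries; rewrite (entire_PSeries a Im abs_Im_le_Cmod Ha); exact I|].
    apply PSeries_ext; intros n; unfold Cderiv_coef, PS_derive; now rewrite im_scal_l.
Qed.

Lemma CPSeries_0 (a : nat -> C) : CPSeries a 0 = a 0%nat.
Proof. unfold CPSeries; rewrite !PSeries_0; now destruct (a 0%nat). Qed.

(** * Complex series and the double series of Kampe de Feriet type *)

(** [CSeries] is total and has a value even for a divergent series; this relation carries the
    convergence that gives the value its meaning. *)
Definition is_Cseries (u : nat -> C) (l : C) : Prop :=
  is_series (fun n => Re (u n)) (Re l) /\ is_series (fun n => Im (u n)) (Im l).

Lemma CSeries_unique (u : nat -> C) (l : C) : is_Cseries u l -> CSeries u = l.
Proof.
  intros [H1 H2]; unfold CSeries.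
  rewrite (is_series_unique _ _ H1), (is_series_unique _ _ H2); now destruct l.
Qed.

Lemma CSeries_ext (u v : nat -> C) : (forall n, u n = v n) -> CSeries u = CSeries v.
Proof. intros E; unfold CSeries; f_equal; apply Series_ext; intros n; now rewrite E. Qed.

Lemma is_Cseries_ext (u v : nat -> C) (l : C) :
  (forall n, u n = v n) -> is_Cseries u l -> is_Cseries v l.
Proof.
  intros E [H1 H2]; split.
  - apply (is_series_ext (fun n => Re (u n))); [intros n; now rewrite E | exact H1].
  - apply (is_series_ext (fun n => Im (u n))); [intros n; now rewrite E | exact H2].
Qed.

Lemma is_Cseries_plus (u v : nat -> C) (l m : C) :
  is_Cseries u l -> is_Cseries v m -> is_Cseries (fun n => u n + v n)%C (l + m)%C.
Proof.
  intros [A1 A2] [B1 B2]; split.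
  - exact (is_series_plus _ _ _ _ A1 B1).
  - exact (is_series_plus _ _ _ _ A2 B2).
Qed.

Lemma is_Cseries_scal (z : C) (u : nat -> C) (l : C) :
  is_Cseries u l -> is_Cseries (fun n => z * u n)%C (z * l)%C.
Proof.
  intros [A1 A2]; split.
  - apply (is_series_ext (fun n => Re z * Re (u n) - Im z * Im (u n)));
      [intros n; now rewrite re_mult|].
    rewrite re_mult.
    exact (is_series_minus _ _ _ _ (is_series_scal_l (Re z) _ _ A1)
      (is_series_scal_l (Im z) _ _ A2)).
  - apply (is_series_ext (fun n => Re z * Im (u n) + Im z * Re (u n)));
      [intros n; now rewrite im_mult|].
    rewrite im_mult.
    exact (is_series_plus _ _ _ _ (is_series_scal_l (Re z) _ _ A2)
      (is_series_scal_l (Im z) _ _ A1)).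
Qed.

Lemma entire_is_series (a : nat -> C) (h : C -> R) (x : R) :
  (forall z, Rabs (h z) <= Cmod z) -> entire a ->
  is_series (fun n => h (a n) * x ^ n) (PSeries (fun n => h (a n)) x).
Proof.
  intros Hh Ha; unfold PSeries; apply Series_correct, ex_series_Rabs.
  apply (CV_disk_inside (fun n => h (a n))).
  rewrite (entire_PSeries a h Hh Ha); exact I.
Qed.

Lemma CPSeries_correct (a : nat -> C) (x : R) :
  entire a -> is_Cseries (fun n => a n * RtoC x ^ n)%C (CPSeries a x).
Proof.
  intros Ha; split; unfold CPSeries; cbn [Re Im fst snd].
  - apply (is_series_ext (fun n => Re (a n) * x ^ n));
      [intros n; now rewrite <- RtoC_pow, re_scal_r|].
    apply entire_is_series; [exact re_le_Cmod | exact Ha].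
  - apply (is_series_ext (fun n => Im (a n) * x ^ n));
      [intros n; now rewrite <- RtoC_pow, im_scal_r|].
    apply entire_is_series; [exact abs_Im_le_Cmod | exact Ha].
Qed.

Lemma CPSeries_unique (a : nat -> C) (x : R) (l : C) :
  entire a -> is_Cseries (fun n => a n * RtoC x ^ n)%C l -> CPSeries a x = l.
Proof.
  intros Ha H; rewrite <- (CSeries_unique _ _ H).
  symmetry; apply CSeries_unique, CPSeries_correct, Ha.
Qed.

Lemma CPSeries_CSeries (a : nat -> C) (x : R) :
  CPSeries a x = CSeries (fun n => a n * RtoC x ^ n)%C.
Proof.
  unfold CPSeries, CSeries, PSeries; f_equal; apply Series_ext; intros n; rewrite <- RtoC_pow.
  - now rewrite re_scal_r.
  - now rewrite im_scal_r.
Qed.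

Lemma CPSeries_ext (a b : nat -> C) (x : R) :
  (forall n, a n = b n) -> CPSeries a x = CPSeries b x.
Proof. intros E; rewrite !CPSeries_CSeries; apply CSeries_ext; intros n; now rewrite E. Qed.

Lemma CPSeries_plus (a b : nat -> C) (x : R) :
  entire a -> entire b ->
  CPSeries (fun n => a n + b n)%C x = (CPSeries a x + CPSeries b x)%C.
Proof.
  intros Ha Hb; rewrite CPSeries_CSeries; apply CSeries_unique.
  apply (is_Cseries_ext (fun n => a n * RtoC x ^ n + b n * RtoC x ^ n)%C); [intros n; ring|].
  apply is_Cseries_plus; now apply CPSeries_correct.
Qed.

Lemma CPSeries_scal (z : C) (a : nat -> C) (x : R) :
  entire a -> CPSeries (fun n => z * a n)%C x = (z * CPSeries a x)%C.
Proof.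
  intros Ha; rewrite CPSeries_CSeries; apply CSeries_unique.
  apply (is_Cseries_ext (fun n => z * (a n * RtoC x ^ n))%C); [intros n; ring|].
  now apply is_Cseries_scal, CPSeries_correct.
Qed.

Lemma CPSeries_conj (a : nat -> C) (x : R) :
  CPSeries (fun n => Cconj (a n)) x = Cconj (CPSeries a x).
Proof.
  unfold CPSeries, Cconj; cbn [fst snd]; f_equal.
  unfold Im; rewrite <- PSeries_opp; reflexivity.
Qed.

Definition Cshift (a : nat -> C) (n : nat) : C :=
  match n with O => 0%C | S m => a m end.

Lemma CPSeries_shift (a : nat -> C) (x : R) :
  CPSeries (Cshift a) x = (x * CPSeries a x)%C.
Proof.
  unfold CPSeries.
  rewrite (PSeries_ext (fun n => Re (Cshift a n)) (PS_incr_1 (fun n => Re (a n))))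
    by (intros [|n]; reflexivity).
  rewrite (PSeries_ext (fun n => Im (Cshift a n)) (PS_incr_1 (fun n => Im (a n))))
    by (intros [|n]; reflexivity).
  rewrite !PSeries_incr_1; unfold Cmult, RtoC; cbn [fst snd]; f_equal; ring.
Qed.

(** The Euler operator x d/dx is diagonal on coefficients, which removes the index shift of a plain
    derivative. *)
Lemma CPSeries_euler (a : nat -> C) (x : R) :
  (x * CPSeries (Cderiv_coef a) x)%C = CPSeries (fun n => INR n * a n)%C x.
Proof.
  rewrite <- CPSeries_shift; apply CPSeries_ext; intros [|n];
    [symmetry; apply Cmult_0_l | reflexivity].
Qed.

Lemma entire_scal (z : C) (a : nat -> C) : entire a -> entire (fun n => z * a n)%C.
Proof.
  intros Ha r Hr.
  apply (ex_series_ext (fun n => Cmod z * (Cmod (a n) * r ^ n)));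
    [intros n; rewrite Cmod_mult; symmetry; apply Rmult_assoc|].
  now apply (@ex_series_scal_l R_AbsRing), Ha.
Qed.

Lemma is_series_tail_le (u v : nat -> R) (l m : R) (n : nat) :
  (forall k, Rabs (u k) <= v k) -> is_series u l -> is_series v m ->
  Rabs (l - sum_n u n) <= m - sum_n v n.
Proof.
  intros H Hu Hv.
  (* [sum_n w n] includes the term of index n, so the tail starts at [S n]. *)
  assert (T : forall (w : nat -> R) (t : R), is_series w t ->
    is_series (fun k => w (S n + k)%nat) (t - sum_n w n)).
  { intros w t Hw.
    apply (is_series_incr_n w (S n) (t - sum_n w n)); [lia|].
    assert (E : t = t - sum_n w n + sum_n w n) by ring.
    rewrite E in Hw; exact Hw. }
  apply T in Hu; apply T in Hv.
  rewrite <- (is_series_unique _ _ Hu), <- (is_series_unique _ _ Hv).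
  assert (X : ex_series (fun k => Rabs (u (S n + k)%nat))).
  { apply (@ex_series_le R_AbsRing R_CompleteNormedModule _ (fun k => v (S n + k)%nat)).
    - intros k; unfold norm; simpl; unfold abs; simpl; rewrite Rabs_Rabsolu; apply H.
    - eexists; exact Hv. }
  apply Rle_trans with (1 := Series_Rabs _ X).
  apply Series_le; [|eexists; exact Hv].
  intros k; split; [apply Rabs_pos | apply H].
Qed.

Lemma Re_sum_n (u : nat -> C) (n : nat) : Re (sum_n u n) = sum_n (fun k => Re (u k)) n.
Proof.
  induction n as [|n IH]; [now rewrite !sum_O|].
  rewrite !sum_Sn, <- IH; reflexivity.
Qed.

Lemma Im_sum_n (u : nat -> C) (n : nat) : Im (sum_n u n) = sum_n (fun k => Im (u k)) n.
Proof.
  induction n as [|n IH]; [now rewrite !sum_O|].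
  rewrite !sum_Sn, <- IH; reflexivity.
Qed.

(** A quantitative Weierstrass test: the bound is the remainder of the majorant at r, hence uniform
    in y on the interval. The factor 2 comes from adding real and imaginary parts. *)
Lemma CPSeries_tail_le (a : nat -> C) (r y : R) (n : nat) :
  entire a -> Rabs y <= r ->
  Cmod (CPSeries a y - sum_n (fun k => a k * RtoC y ^ k)%C n)%C <=
  2 * (Series (fun k => Cmod (a k) * r ^ k) - sum_n (fun k => Cmod (a k) * r ^ k) n).
Proof.
  intros Ha Hy.
  assert (Hr : 0 <= r) by (apply Rle_trans with (2 := Hy), Rabs_pos).
  assert (Hv := Series_correct _ (Ha r Hr)).
  destruct (CPSeries_correct a y Ha) as [H1 H2].
  assert (B : forall k, Cmod (a k * RtoC y ^ k)%C <= Cmod (a k) * r ^ k).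
  { intros k; rewrite Cmod_mult, <- RtoC_pow, Cmod_R, <- RPow_abs.
    apply Rmult_le_compat_l; [apply Cmod_ge_0|].
    apply pow_incr; split; [apply Rabs_pos | exact Hy]. }
  assert (T1 := is_series_tail_le _ _ _ _ n
    (fun k => Rle_trans _ _ _ (re_le_Cmod _) (B k)) H1 Hv).
  assert (T2 := is_series_tail_le _ _ _ _ n
    (fun k => Rle_trans _ _ _ (abs_Im_le_Cmod _) (B k)) H2 Hv).
  apply Rle_trans with (1 := Cmod_le_abs _).
  unfold Cminus; rewrite re_plus, im_plus, re_opp, im_opp, Re_sum_n, Im_sum_n.
  apply Rle_trans with (1 := Rplus_le_compat _ _ _ _ T1 T2); lra.
Qed.

Lemma CPSeries_bounded (a : nat -> C) (r : R) :
  entire a -> exists M, forall y, Rabs y <= r -> Cmod (CPSeries a y) <= M.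
Proof.
  intros Ha.
  exists (2 * (Series (fun k => Cmod (a k) * r ^ k) - Cmod (a 0%nat)) + Cmod (a 0%nat)).
  intros y Hy.
  assert (T := CPSeries_tail_le a r y 0 Ha Hy).
  rewrite !sum_O in T; simpl pow in T; rewrite Rmult_1_r in T.
  replace (CPSeries a y) with ((CPSeries a y - a 0%nat * RtoC y ^ 0) + a 0%nat)%C
    by (simpl; ring).
  apply Rle_trans with (1 := Cmod_triangle _ _); lra.
Qed.

Lemma is_Cseries_of_remainder (u : nat -> C) (l : C) (e : nat -> R) :
  (forall n, Cmod (l - sum_n u n)%C <= e n) -> is_lim_seq e 0 -> is_Cseries u l.
Proof.
  intros H He.
  assert (L : forall (w : nat -> R) (t : R),
    (forall n, Rabs (t - sum_n w n) <= e n) -> is_series w t).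
  { intros w t Hw.
    assert (Z : is_lim_seq (fun n => t - sum_n w n) 0).
    { apply is_lim_seq_abs_0, is_lim_seq_le_le with (fun _ => 0) e;
        [intros n; split; [apply Rabs_pos | apply Hw] | apply is_lim_seq_const | exact He]. }
    change (is_lim_seq (sum_n w) t).
    apply (is_lim_seq_ext (fun n => t - (t - sum_n w n))); [intros n; ring|].
    evar_last; [exact (is_lim_seq_minus' _ _ _ _ (is_lim_seq_const t) Z)|].
    f_equal; ring. }
  split; apply L; intros n.
  - apply Rle_trans with (2 := H n), Rle_trans with (2 := re_le_Cmod _).
    unfold Cminus; rewrite re_plus, re_opp, Re_sum_n; right; reflexivity.
  - apply Rle_trans with (2 := H n), Rle_trans with (2 := abs_Im_le_Cmod _).
    unfold Cminus; rewrite im_plus, im_opp, Im_sum_n; right; reflexivity.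
Qed.

Lemma is_Cderive_sum_n (f df : nat -> R -> C) (x : R) (n : nat) :
  (forall j, is_Cderive (f j) x (df j x)) ->
  is_Cderive (fun t => sum_n (fun j => f j t) n) x (sum_n (fun j => df j x) n).
Proof.
  intros H; induction n as [|n IH].
  - rewrite sum_O; apply (is_Cderive_ext (f 0%nat)); [intros t; now rewrite sum_O | apply H].
  - rewrite sum_Sn.
    apply (is_Cderive_ext (fun t => sum_n (fun j => f j t) n + f (S n) t)%C);
      [intros t; now rewrite sum_Sn|].
    apply (is_Cderive_plus _ _ _ _ _ IH (H (S n))).
Qed.

(** * Antiderivatives and termwise integration *)

Lemma antiderivative (f : R -> R) :
  (forall x, ex_derive f x) -> exists F, F 0 = 0 /\ forall x, is_derive F x (f x).
Proof.
  intros H.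
  assert (Hc : forall x, continuous f x)
    by (intros x; apply (@ex_derive_continuous R_AbsRing R_NormedModule), H).
  exists (fun x => RInt f 0 x); split; [apply (RInt_point 0 f)|].
  intros x; apply (is_derive_RInt f (fun x => RInt f 0 x) 0 x); [|apply Hc].
  exists (mkposreal 1 Rlt_0_1); intros y _.
  apply (@RInt_correct R_CompleteNormedModule), ex_RInt_continuous; intros; apply Hc.
Qed.

Lemma Cantiderivative (f : R -> C) :
  (forall x, exists l, is_Cderive f x l) ->
  exists F : R -> C, F 0 = 0%C /\ forall x, is_Cderive F x (f x).
Proof.
  intros H.
  destruct (antiderivative (fun t => Re (f t))) as [F1 [Z1 H1]].
  { intros x; destruct (H x) as [l Hl]; exists (Re l); apply Hl. }
  destruct (antiderivative (fun t => Im (f t))) as [F2 [Z2 H2]].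
  { intros x; destruct (H x) as [l Hl]; exists (Im l); apply Hl. }
  exists (fun x => (F1 x, F2 x)); split; [now rewrite Z1, Z2|].
  intros x; split; [apply H1 | apply H2].
Qed.

(** Termwise integration: the primitive of t^p b(t^2) vanishing at 0 is x^(p+1) times the series in
    x^2 with these coefficients. *)
Definition moment_coef (p : nat) (b : nat -> C) (k : nat) : C :=
  (b k / INR (2 * k + S p))%C.

Lemma INR_S_neq0 (n : nat) : RtoC (INR (S n)) <> 0%C.
Proof. intros E; apply RtoC_inj in E; revert E; apply not_0_INR; lia. Qed.

Lemma Cmod_div_INR_le (z : C) (n : nat) : Cmod (z / INR (S n))%C <= Cmod z.
Proof.
  assert (P : 1 <= INR (S n)) by (apply (le_INR 1); lia).
  rewrite Cmod_div by apply INR_S_neq0; rewrite Cmod_R, Rabs_pos_eq by lra.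
  apply Rle_div_l; [lra|].
  rewrite <- (Rmult_1_r (Cmod z)) at 1.
  apply Rmult_le_compat_l; [apply Cmod_ge_0 | exact P].
Qed.

Lemma entire_moment (p : nat) (b : nat -> C) : entire b -> entire (moment_coef p b).
Proof.
  apply entire_le; intros n; unfold moment_coef.
  rewrite Nat.add_succ_r; apply Cmod_div_INR_le.
Qed.

(** In y = x^2 the derivative acts on the series as p + 1 + 2 y d/dy, which multiplies the
    coefficient of index n by 2n + p + 1 and so cancels the denominator of [moment_coef]. *)
Lemma is_Cderive_moment (p : nat) (b : nat -> C) (x : R) :
  entire b ->
  is_Cderive (fun t => RtoC t ^ S p * CPSeries (moment_coef p b) (t ^ 2))%C x
    (RtoC x ^ p * CPSeries b (x ^ 2))%C.
Proof.
  intros Hb; assert (Hm := entire_moment p b Hb).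
  apply (is_Cderive_eq _ _ _ _ (is_Cderive_mult _ _ _ _ _ (is_Cderive_pow p x)
    (is_Cderive_comp_sqr _ _ _ (is_Cderive_CPSeries _ (x ^ 2) Hm)))).
  transitivity (RtoC x ^ p * (INR (S p) * CPSeries (moment_coef p b) (x ^ 2) +
    2 * (RtoC (x ^ 2) * CPSeries (Cderiv_coef (moment_coef p b)) (x ^ 2))))%C.
  { rewrite RtoC_pow; simpl Cpow; ring. }
  f_equal; rewrite CPSeries_euler.
  symmetry; apply CPSeries_unique; [exact Hb|].
  (* The factor n / (2n + p + 1) is at most 1, so these coefficients are dominated by those of
     [b]. *)
  assert (He : entire (fun n => INR n * moment_coef p b n)%C).
  { apply (entire_le _ b); [|exact Hb]; intros n; unfold moment_coef.
    rewrite Cmod_mult, Cmod_div, !Cmod_R, !Rabs_pos_eq;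
      [|apply pos_INR|apply pos_INR|rewrite Nat.add_succ_r; apply INR_S_neq0].
    assert (P : 0 < INR (2 * n + S p)) by (apply lt_0_INR; lia).
    assert (Q : INR n <= INR (2 * n + S p)) by (apply le_INR; lia).
    replace (INR n * (Cmod (b n) / INR (2 * n + S p)))
      with (INR n / INR (2 * n + S p) * Cmod (b n)) by (field; lra).
    rewrite <- (Rmult_1_l (Cmod (b n))) at 2.
    apply Rmult_le_compat_r; [apply Cmod_ge_0|].
    apply Rle_div_l; lra. }
  apply (is_Cseries_ext (fun n => INR (S p) * (moment_coef p b n * RtoC (x ^ 2) ^ n) +
    2 * (INR n * moment_coef p b n * RtoC (x ^ 2) ^ n))%C).
  - intros n; unfold moment_coef.
    assert (Z := INR_S_neq0 (2 * n + p)); rewrite <- Nat.add_succ_r in Z.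
    assert (E : RtoC (INR (2 * n + S p)) = (2 * INR n + INR (S p))%C)
      by (rewrite plus_INR, mult_INR, RtoC_plus, RtoC_mult; reflexivity).
    rewrite E in Z |- *; field; exact Z.
  - apply is_Cseries_plus; apply is_Cseries_scal; now apply CPSeries_correct.
Qed.

(* The partial sums over [j] are antiderivatives of [x^p] times the product of
   the second series with a partial sum of the first, so the mean value
   inequality reduces the claim to uniform convergence of the first series. *)
Lemma is_Cderive_double_series (p : nat) (a b : nat -> C) (x : R) :
  entire a -> entire b ->
  is_Cderive (fun t => RtoC t ^ S p * CSeries (fun j => CSeries (fun k =>
      a j * b k / INR (2 * (j + k) + S p) * RtoC (t ^ 2) ^ (j + k))))%C x
    (RtoC x ^ p * (CPSeries a (x ^ 2) * CPSeries b (x ^ 2)))%C.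
Proof.
  intros Ha Hb.
  set (h := fun (j : nat) (t : R) =>
    (RtoC t ^ S (2 * j + p) * CPSeries (moment_coef (2 * j + p) b) (t ^ 2))%C).
  (* [J] is the primitive of the claimed derivative that vanishes at 0; it remains to identify it
     with the double sum. *)
  destruct (Cantiderivative
    (fun t => RtoC t ^ p * (CPSeries a (t ^ 2) * CPSeries b (t ^ 2)))%C) as [J [J0 HJ]].
  { intros t.
    assert (Hp : exists l, is_Cderive (fun t => RtoC t ^ p)%C t l).
    { destruct p as [|q]; eexists; [exact (is_Cderive_const 1 t) | exact (is_Cderive_pow q t)]. }
    destruct Hp as [l Hl]; eexists.
    apply is_Cderive_mult; [exact Hl|].
    apply is_Cderive_mult; now apply is_Cderive_comp_sqr, is_Cderive_CPSeries. }
  apply (is_Cderive_ext J); [|apply HJ].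
  intros y.
  (* For fixed j the inner sum is a moment series of exponent 2j + p, since 2(j + k) + p + 1 = 2k +
     (2j + p) + 1. *)
  assert (Hinner : forall j, CSeries (fun k =>
      a j * b k / INR (2 * (j + k) + S p) * RtoC (y ^ 2) ^ (j + k))%C =
    (a j * RtoC y ^ (2 * j) * CPSeries (moment_coef (2 * j + p) b) (y ^ 2))%C).
  { intros j; apply CSeries_unique.
    apply (is_Cseries_ext (fun k => a j * RtoC y ^ (2 * j) *
      (moment_coef (2 * j + p) b k * RtoC (y ^ 2) ^ k))%C).
    - intros k; unfold moment_coef.
      replace (2 * k + S (2 * j + p))%nat with (2 * (j + k) + S p)%nat by lia.
      rewrite Cpow_add_r, Cpow_mult_r, !RtoC_pow; unfold Cdiv; ring.
    - now apply is_Cseries_scal, CPSeries_correct, entire_moment. }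
  rewrite (CSeries_ext _ _ Hinner).
  assert (HS : is_Cseries (fun j => a j * h j y)%C (J y)).
  { set (r := Rabs y).
    destruct (CPSeries_bounded b (r ^ 2) Hb) as [M HM].
    assert (Hr : 0 <= r) by apply Rabs_pos.
    set (v := fun k => Cmod (a k) * (r ^ 2) ^ k).
    assert (Hv : is_lim_seq (fun n => Series v - sum_n v n) 0).
    { evar_last; [apply is_lim_seq_minus'; [apply is_lim_seq_const|]|].
      - exact (Series_correct _ (Ha (r ^ 2) (pow2_ge_0 r))).
      - fold v; f_equal; ring. }
    (* The 4 is the 2 of [Cmean_value] times the 2 of [CPSeries_tail_le]. *)
    apply (is_Cseries_of_remainder _ _
      (fun n => 4 * r ^ p * M * r * (Series v - sum_n v n))).
    2:{ evar_last; [apply is_lim_seq_scal_l, Hv | simpl; f_equal; ring]. }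
    intros n.
    set (P := fun t : R => sum_n (fun k => a k * RtoC (t ^ 2) ^ k)%C n : C).
    assert (D := Cmean_value (fun t => J t - sum_n (fun j => a j * h j t)%C n)%C
      (fun t => RtoC t ^ p * CPSeries b (t ^ 2) * (CPSeries a (t ^ 2) - P t))%C
      (r ^ p * M * (2 * (Series v - sum_n v n))) y).
    cbv beta in D.
    (* The difference of [J] and the partial sum vanishes at 0; subtracting that value gives the
       shape of the mean value inequality. *)
    replace (J y - sum_n (fun j => a j * h j y)%C n)%C with
      (J y - sum_n (fun j => a j * h j y)%C n - (J 0 - sum_n (fun j => a j * h j 0)%C n))%C.
    - eapply Rle_trans; [apply D | fold r; right; ring].
      intros t Ht; split.
      + assert (HD := is_Cderive_minus _ _ _ _ _ (HJ t)
          (is_Cderive_sum_n (fun j t => a j * h j t)%C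
          (fun j t => a j * (RtoC t ^ (2 * j + p) * CPSeries b (t ^ 2)))%C t n
          (fun j => is_Cderive_scal (a j) _ _ _ (is_Cderive_moment (2 * j + p) b t Hb)))).
        apply (is_Cderive_eq _ _ _ _ HD).
        replace (sum_n (fun j => a j * (RtoC t ^ (2 * j + p) * CPSeries b (t ^ 2)))%C n)
          with (RtoC t ^ p * CPSeries b (t ^ 2) * P t)%C; [ring|].
        unfold P; etransitivity; [exact (eq_sym (@sum_n_mult_l C_Ring _ _ n))|].
        apply sum_n_ext; intros k; unfold mult; simpl mult.
        rewrite Cpow_add_r, Cpow_mult_r, !RtoC_pow; cbn; ring.
      + fold r in Ht.
        assert (Hq : Rabs (t ^ 2) <= r ^ 2).
        { rewrite <- RPow_abs; apply pow_incr; split; [apply Rabs_pos | exact Ht]. }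
        assert (T := CPSeries_tail_le a (r ^ 2) (t ^ 2) n Ha Hq); fold v in T.
        rewrite !Cmod_mult, <- RtoC_pow, Cmod_R, <- RPow_abs.
        apply Rmult_le_compat; [|apply Cmod_ge_0| |exact T].
        * apply Rmult_le_pos; [apply pow_le, Rabs_pos | apply Cmod_ge_0].
        * apply Rmult_le_compat; [apply pow_le, Rabs_pos | apply Cmod_ge_0 | |].
          -- apply pow_incr; split; [apply Rabs_pos | exact Ht].
          -- now apply HM.
    - replace (sum_n (fun j => a j * h j 0)%C n) with (RtoC 0); [rewrite J0; ring|].
      clear D; induction n as [|n IH]; [rewrite sum_O | rewrite sum_Sn, <- IH];
        unfold h; simpl Cpow; [|unfold plus; simpl]; ring. }
  (* The sum obtained for [J y] carries the factor y^(p+1). It is divided out for nonzero y; at 0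
     both sides vanish. *)
  destruct (Req_dec y 0) as [->|Hy].
  - rewrite J0; simpl Cpow; ring.
  - assert (Z : RtoC y <> 0%C) by (intros E; apply RtoC_inj in E; contradiction).
    assert (Zp : (RtoC y ^ S p)%C <> 0%C) by now apply Cpow_nz.
    rewrite (CSeries_unique _ (/ RtoC y ^ S p * J y)%C).
    { field; exact Zp. }
    apply (is_Cseries_ext (fun j => / RtoC y ^ S p * (a j * h j y))%C);
      [|now apply is_Cseries_scal].
    intros j; unfold h; rewrite <- Nat.add_succ_r, Cpow_add_r; field; exact Zp.
Qed.

(** * Kummer functions *)

Lemma RtoC_neq0 (r : R) : r <> 0 -> RtoC r <> 0%C.
Proof. intros H E; apply RtoC_inj in E; contradiction. Qed.

Lemma pochhammer_neq0 (b : C) (n : nat) : 0 < Re b -> pochhammer b n <> 0%C.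
Proof.
  intros Hb; induction n as [|n IH]; cbn [pochhammer].
  - apply RtoC_neq0; lra.
  - apply Cmult_neq_0; [exact IH|].
    intros E; apply (f_equal Re) in E; revert E; rewrite re_plus, !re_RtoC.
    generalize (pos_INR n); lra.
Qed.

Lemma pochhammer_shift (a : C) (n : nat) :
  (a * pochhammer (a + 1) n)%C = pochhammer a (S n).
Proof.
  induction n as [|n IH]; [cbn [pochhammer INR]; ring|].
  cbn [pochhammer]; rewrite Cmult_assoc, IH, S_INR, RtoC_plus; cbn [pochhammer]; ring.
Qed.

(** The complex direction [w] of the argument is absorbed in the coefficients, which leaves a series
    in a real variable. *)
Definition kummer_coef (a b w : C) (n : nat) : C :=
  (pochhammer a n / pochhammer b n * (w ^ n / INR (fact n)))%C.

Lemma INR_fact_C_neq0 (n : nat) : RtoC (INR (fact n)) <> 0%C.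
Proof. apply RtoC_neq0, INR_fact_neq_0. Qed.

Lemma hyp1F1_CPSeries (a b w : C) (y : R) :
  hyp1F1 a b (w * y)%C = CPSeries (kummer_coef a b w) y.
Proof.
  rewrite CPSeries_CSeries; apply CSeries_ext; intros n; unfold kummer_coef.
  rewrite Cpow_mult_l; unfold Cdiv; ring.
Qed.

Lemma kummer_coef_S (a b w : C) (n : nat) :
  0 < Re b ->
  (kummer_coef a b w (S n) * INR (S n))%C =
  (kummer_coef a b w n * ((a + INR n) / (b + INR n) * w))%C.
Proof.
  intros Hb; unfold kummer_coef.
  assert (N := pochhammer_neq0 b (S n) Hb).
  assert (N0 := pochhammer_neq0 b n Hb).
  assert (N1 := INR_fact_C_neq0 n).
  assert (N2 := INR_S_neq0 n).
  rewrite fact_simpl, mult_INR, RtoC_mult; cbn [pochhammer Cpow] in N |- *.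
  field; repeat split; try assumption.
  intros E; apply N; rewrite E; ring.
Qed.

(** Since |b + n| is at least n + 1/2 and |a + n| at most |a| + n, their quotient is at most 2|a| +
    1 for every n, and [entire_ratio] applies. *)
Lemma entire_kummer (a b w : C) : 1 / 2 <= Re b -> entire (kummer_coef a b w).
Proof.
  intros Hb.
  apply entire_ratio with ((2 * Cmod a + 1) * Cmod w); intros n.
  assert (P := pos_INR n); assert (Pa := Cmod_ge_0 a).
  rewrite <- (Rabs_pos_eq (INR (S n))) by apply pos_INR.
  rewrite <- Cmod_R, <- Cmod_mult, kummer_coef_S by lra.
  assert (B : INR n + 1 / 2 <= Cmod (b + INR n)%C).
  { apply Rle_trans with (2 := re_le_Cmod _), Rle_trans with (2 := Rle_abs _).
    rewrite re_plus, re_RtoC; lra. }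
  assert (A : Cmod (a + INR n)%C <= Cmod a + INR n).
  { apply Rle_trans with (1 := Cmod_triangle _ _).
    rewrite Cmod_R, Rabs_pos_eq; lra. }
  rewrite !Cmod_mult, Rmult_comm.
  apply Rmult_le_compat_r; [apply Cmod_ge_0|].
  apply Rmult_le_compat_r; [apply Cmod_ge_0|].
  rewrite Cmod_div by (intros E; rewrite E, Cmod_0 in B; lra).
  apply Rle_div_l; [lra|].
  apply Rle_trans with (1 := A); nra.
Qed.

Lemma RtoC_half : (1 / 2)%C = RtoC (1 / 2).
Proof. now rewrite RtoC_div. Qed.

Lemma RtoC_three_halves : (3 / 2)%C = RtoC (3 / 2).
Proof. now rewrite RtoC_div. Qed.

Lemma entire_kummer_half (a w : C) : entire (kummer_coef a (1 / 2) w).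
Proof. apply entire_kummer; rewrite RtoC_half, re_RtoC; lra. Qed.

Lemma entire_kummer_three_halves (a w : C) : entire (kummer_coef a (3 / 2) w).
Proof. apply entire_kummer; rewrite RtoC_three_halves, re_RtoC; lra. Qed.

Lemma pochhammer_half_neq0 (n : nat) : pochhammer (1 / 2) n <> 0%C.
Proof. apply pochhammer_neq0; rewrite RtoC_half, re_RtoC; lra. Qed.

Lemma pochhammer_three_halves_neq0 (n : nat) : pochhammer (3 / 2) n <> 0%C.
Proof. apply pochhammer_neq0; rewrite RtoC_three_halves, re_RtoC; lra. Qed.

Lemma INR_double_S (n p : nat) :
  RtoC (INR (2 * n + S p)) = (2 * INR n + INR p + 1)%C.
Proof.
  rewrite Nat.add_succ_r, S_INR, plus_INR, mult_INR, !RtoC_plus, RtoC_mult; reflexivity.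
Qed.

Lemma pochhammer_three_halves (n : nat) :
  pochhammer (3 / 2) n = (pochhammer (1 / 2) n * INR (2 * n + 1))%C.
Proof.
  rewrite INR_double_S; cbn [INR].
  induction n as [|n IH]; cbn [pochhammer]; [cbn [INR]; ring|].
  rewrite IH, S_INR, RtoC_plus; field; apply RtoC_neq0; lra.
Qed.

Lemma pochhammer_two (n : nat) : pochhammer 2 n = (pochhammer 1 n * INR (S n))%C.
Proof.
  induction n as [|n IH]; [cbn [pochhammer INR]; ring|].
  cbn [pochhammer] in *; rewrite IH, !S_INR, !RtoC_plus; ring.
Qed.

(** Raising the lower parameter from 1/2 to 3/2 divides the coefficient by 2n + 1, which is termwise
    integration in x. This is why the derivative of [xV] is [U]. *)
Lemma kummer_coef_three_halves (a w : C) (n : nat) :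
  kummer_coef a (3 / 2) w n = moment_coef 0 (kummer_coef a (1 / 2) w) n.
Proof.
  unfold kummer_coef, moment_coef; rewrite pochhammer_three_halves.
  assert (N := INR_S_neq0 (2 * n)); rewrite <- Nat.add_1_r in N.
  field; repeat split;
    auto using INR_fact_C_neq0, pochhammer_half_neq0.
Qed.

Definition half_i : C := (Ci / 2)%C.

Lemma two_neq0 : RtoC 2 <> 0%C.
Proof. apply RtoC_neq0; lra. Qed.

Lemma zeta_mul (x : R) : zeta x = (half_i * RtoC (x ^ 2))%C.
Proof. unfold zeta, half_i; rewrite RtoC_pow; field; exact two_neq0. Qed.

Lemma opp_zeta_mul (x : R) : (- zeta x)%C = (- half_i * RtoC (x ^ 2))%C.
Proof. rewrite zeta_mul; ring. Qed.

Lemma U_CPSeries (ch x : R) : U ch x = CPSeries (kummer_coef (mu ch) (1 / 2) half_i) (x ^ 2).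
Proof. unfold U; now rewrite zeta_mul, hyp1F1_CPSeries. Qed.

Lemma V_CPSeries (ch x : R) : V ch x = CPSeries (kummer_coef (mu ch) (3 / 2) half_i) (x ^ 2).
Proof. unfold V; now rewrite zeta_mul, hyp1F1_CPSeries. Qed.

Lemma kummer_coef_0 (a b w : C) : kummer_coef a b w 0 = 1%C.
Proof.
  unfold kummer_coef; cbn [pochhammer Cpow fact INR]; field; apply RtoC_neq0; lra.
Qed.

Lemma zero_pow2 : 0 ^ 2 = 0.
Proof. ring. Qed.

Lemma U_0 (ch : R) : U ch 0 = 1%C.
Proof. now rewrite U_CPSeries, zero_pow2, CPSeries_0, kummer_coef_0. Qed.

Definition xV (ch x : R) : C := (x * V ch x)%C.

Lemma is_Cderive_xV (ch x : R) : is_Cderive (xV ch) x (U ch x).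
Proof.
  assert (H := is_Cderive_moment 0 _ x (entire_kummer_half (mu ch) half_i)).
  apply (is_Cderive_ext _ (xV ch)) in H.
  - apply (is_Cderive_eq _ _ _ _ H); rewrite U_CPSeries; cbn [Cpow]; ring.
  - intros t; unfold xV; rewrite V_CPSeries; cbn [Cpow].
    rewrite (CPSeries_ext _ _ _ (kummer_coef_three_halves (mu ch) half_i)); ring.
Qed.

Lemma Ci_sqr : (Ci * Ci)%C = (- (1))%C.
Proof. unfold Ci, Cmult, Copp, RtoC; cbn [fst snd]; f_equal; ring. Qed.

(** The quotient (mu + n)/(n + 1/2) in the coefficient recurrence equals 1 + (i chi^2/4)/(2n + 1):
    the first summand reproduces [U], the second, divided by 2n + 1, gives [V]. The value of [mu] is
    exactly the one that makes the second coefficient real and negative. *)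
Lemma is_Cderive_U (ch x : R) :
  is_Cderive (U ch) x (Ci * x * U ch x - ch ^ 2 / 4 * xV ch x)%C.
Proof.
  assert (H := is_Cderive_comp_sqr _ x _
    (is_Cderive_CPSeries _ (x ^ 2) (entire_kummer_half (mu ch) half_i))).
  apply (is_Cderive_ext _ (U ch)) in H; [|intros t; now rewrite U_CPSeries].
  apply (is_Cderive_eq _ _ _ _ H).
  unfold xV; rewrite U_CPSeries, V_CPSeries.
  rewrite (CPSeries_ext _ (fun n => Ci / 2 * kummer_coef (mu ch) (1 / 2) half_i n +
    - (ch ^ 2 / 8) * kummer_coef (mu ch) (3 / 2) half_i n)%C).
  - assert (E1 := entire_kummer_half (mu ch) half_i).
    assert (E2 := entire_kummer_three_halves (mu ch) half_i).
    set (u := kummer_coef (mu ch) (1 / 2) half_i) in *.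
    set (v := kummer_coef (mu ch) (3 / 2) half_i) in *; clearbody u v.
    rewrite CPSeries_plus, !CPSeries_scal by auto using entire_scal.
    field; split; apply RtoC_neq0; lra.
  - intros n; unfold Cderiv_coef.
    rewrite Cmult_comm, kummer_coef_S by (rewrite RtoC_half, re_RtoC; lra).
    rewrite kummer_coef_three_halves; unfold moment_coef; rewrite INR_double_S.
    unfold half_i, mu; cbn [INR].
    apply Ceq_minus.
    (* [field] treats [Ci] as an atom, so the difference of the two sides is first exhibited as a
       multiple of i^2 + 1. *)
    transitivity (kummer_coef (mu ch) (1 / 2) half_i n * (ch ^ 2 / 8) *
      (Ci * Ci + 1) / (2 * INR n + 1))%C.
    + unfold mu, half_i; field; cbv beta; rewrite <- RtoC_mult, <- RtoC_plus.
      apply RtoC_neq0; generalize (pos_INR n); lra.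
    + rewrite Ci_sqr; unfold Cdiv; ring.
Qed.

(** * Contiguous relations and Kummer's transformation *)

Lemma kummer_coef_succ (a w : C) (n : nat) :
  (INR (S n) * kummer_coef a (1 / 2) w (S n))%C =
  (2 * w * a * kummer_coef (a + 1) (3 / 2) w n)%C.
Proof.
  assert (P : pochhammer (1 / 2) (S n) = (1 / 2 * pochhammer (3 / 2) n)%C).
  { rewrite <- pochhammer_shift; do 2 f_equal; field; exact two_neq0. }
  unfold kummer_coef; rewrite P, <- pochhammer_shift, fact_simpl, mult_INR, RtoC_mult.
  cbn [Cpow]; field; repeat split;
    auto using INR_fact_C_neq0, INR_S_neq0, pochhammer_three_halves_neq0, two_neq0.
Qed.

(** Kummer's equation for f = 1F1(a; 1/2; z) in first-order form: f' = 2 a e with e = 1F1(a+1; 3/2;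
    z), and cancelling 2a leaves z e' = f/2 - e/2 + z e. On coefficients this is checked directly,
    everything of index m + 1 being a multiple of [e m], so no division by [a] occurs. *)
Lemma kummer_coef_contiguous (a w : C) (n : nat) :
  (INR n * kummer_coef (a + 1) (3 / 2) w n)%C =
  (1 / 2 * kummer_coef a (1 / 2) w n + (- (1 / 2)) * kummer_coef (a + 1) (3 / 2) w n
    + w * Cshift (kummer_coef (a + 1) (3 / 2) w) n)%C.
Proof.
  destruct n as [|m].
  - rewrite !kummer_coef_0; cbn [INR Cshift]; ring.
  - cbn [Cshift]; set (e := kummer_coef (a + 1) (3 / 2) w).
    assert (N1 := INR_S_neq0 m).
    assert (N3 : (3 + INR m * 2)%C <> 0%C).
    { rewrite <- RtoC_mult, <- RtoC_plus; apply RtoC_neq0; generalize (pos_INR m); lra. }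
    assert (He : e (S m) = (e m * ((a + 1 + INR m) / (3 / 2 + INR m) * w) / INR (S m))%C).
    { unfold e; rewrite <- kummer_coef_S by (rewrite RtoC_three_halves, re_RtoC; lra).
      field; exact N1. }
    assert (Hb : kummer_coef a (1 / 2) w (S m) = (2 * w * a * e m / INR (S m))%C).
    { unfold e; rewrite <- kummer_coef_succ; field; exact N1. }
    rewrite Hb, He; rewrite S_INR, RtoC_plus in N1 |- *; field.
    repeat split; cbv beta; auto using two_neq0.
Qed.

Lemma entire_plus (a b : nat -> C) :
  entire a -> entire b -> entire (fun n => a n + b n)%C.
Proof.
  intros Ha Hb r Hr.
  apply (@ex_series_le R_AbsRing R_CompleteNormedModule _
    (fun n => Cmod (a n) * r ^ n + Cmod (b n) * r ^ n)).
  - intros n; unfold norm; simpl; unfold abs; simpl.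
    rewrite Rabs_pos_eq by (apply Rmult_le_pos; [apply Cmod_ge_0 | now apply pow_le]).
    rewrite <- Rmult_plus_distr_r.
    apply Rmult_le_compat_r; [now apply pow_le | apply Cmod_triangle].
  - apply (@ex_series_plus R_AbsRing R_NormedModule); [now apply Ha | now apply Hb].
Qed.

Lemma entire_Cshift (a : nat -> C) : entire a -> entire (Cshift a).
Proof.
  intros Ha r Hr; apply ex_series_incr_1.
  apply (ex_series_ext (fun n => r * (Cmod (a n) * r ^ n))).
  - intros n; change (r * (Cmod (a n) * r ^ n) = Cmod (a n) * (r * r ^ n)); ring.
  - now apply (@ex_series_scal_l R_AbsRing), Ha.
Qed.

(** [kummer_X] is the second factor in the product behind [calF]. [kummer_Y] completes it to a
    closed first-order system; the two are to be compared with [U] and [xV] multiplied by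
    e^(-zeta). *)
Definition kummer_X (ch x : R) : C :=
  CPSeries (kummer_coef (1 / 2 - mu ch) (1 / 2) (- half_i)) (x ^ 2).

Definition kummer_Y (ch x : R) : C :=
  (x * CPSeries (kummer_coef (1 / 2 - mu ch + 1) (3 / 2) (- half_i)) (x ^ 2))%C.

Lemma is_Cderive_kummer_X (ch x : R) :
  is_Cderive (kummer_X ch) x (- (ch ^ 2 / 4) * kummer_Y ch x)%C.
Proof.
  assert (H := is_Cderive_comp_sqr _ x _
    (is_Cderive_CPSeries _ (x ^ 2) (entire_kummer_half (1 / 2 - mu ch) (- half_i)))).
  apply (is_Cderive_eq _ _ _ _ H); unfold kummer_Y.
  rewrite (CPSeries_ext _ (fun n => - (ch ^ 2 / 8) *
    kummer_coef (1 / 2 - mu ch + 1) (3 / 2) (- half_i) n)%C).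
  - rewrite CPSeries_scal by apply entire_kummer_three_halves.
    field; split; apply RtoC_neq0; lra.
  - intros n; unfold Cderiv_coef; rewrite kummer_coef_succ; unfold mu, half_i.
    (* Here 2 w a = 2 (-i/2)(-i chi^2/8) = -chi^2/8; the square of [Ci] is isolated for the
       rewrite. *)
    transitivity (2 * (Ci * Ci) * (ch ^ 2 / 16) *
      kummer_coef (1 / 2 - mu ch + 1) (3 / 2) (- half_i) n)%C; unfold mu, half_i.
    + field; repeat split; apply RtoC_neq0; lra.
    + rewrite Ci_sqr; field; repeat split; apply RtoC_neq0; lra.
Qed.

Lemma is_Cderive_kummer_Y (ch x : R) :
  is_Cderive (kummer_Y ch) x (kummer_X ch x - Ci * x * kummer_Y ch x)%C.
Proof.
  set (e := kummer_coef (1 / 2 - mu ch + 1) (3 / 2) (- half_i)).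
  set (b := kummer_coef (1 / 2 - mu ch) (1 / 2) (- half_i)).
  assert (Ee : entire e) by apply entire_kummer_three_halves.
  assert (Eb : entire b) by apply entire_kummer_half.
  assert (H := is_Cderive_mult _ _ _ _ _ (is_Cderive_id x) (is_Cderive_comp_sqr _ x _
    (is_Cderive_CPSeries e (x ^ 2) Ee))).
  apply (is_Cderive_eq _ _ _ _ H); unfold kummer_X, kummer_Y; fold e b.
  transitivity (CPSeries e (x ^ 2) +
     2 * (RtoC (x ^ 2) * CPSeries (Cderiv_coef e) (x ^ 2)))%C; [rewrite RtoC_pow; ring|].
  rewrite CPSeries_euler, (CPSeries_ext (fun n => INR n * e n)%C _ _
    (kummer_coef_contiguous _ _)); fold e b; clearbody e b.
  rewrite !CPSeries_plus, !CPSeries_scal, CPSeries_shift, RtoC_pow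
    by auto using entire_plus, entire_scal, entire_Cshift.
  unfold half_i; field; exact two_neq0.
Qed.

Lemma Cexp_opp_zeta (x : R) : Cexp (- zeta x) = (cos (x ^ 2 / 2), (- sin (x ^ 2 / 2))%R) :> C.
Proof.
  assert (E : (- zeta x)%C = (0, - (x ^ 2 / 2)) :> C).
  { unfold zeta; rewrite <- RtoC_pow.
    unfold Cdiv, Cmult, Cinv, Copp, Ci, RtoC; cbn [fst snd]; f_equal; field. }
  unfold Cexp; rewrite E; cbn [Re Im fst snd].
  rewrite exp_0, cos_neg, sin_neg; unfold Cmult, RtoC; cbn [fst snd]; f_equal; ring.
Qed.

Lemma is_Cderive_Cexp_opp_zeta (x : R) :
  is_Cderive (fun t => Cexp (- zeta t)) x (- (Ci * x * Cexp (- zeta x)))%C.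
Proof.
  apply (is_Cderive_ext (fun t => (cos (t ^ 2 / 2), (- sin (t ^ 2 / 2))%R)));
    [intros t; now rewrite Cexp_opp_zeta|].
  rewrite Cexp_opp_zeta; split; cbn [Re Im fst snd]; auto_derive; trivial;
    unfold Cmult, Copp, Ci, RtoC; cbn [Re Im fst snd];
    change (x * (x * 1) * / 2) with (x ^ 2 / 2); field.
Qed.

Lemma Re_mult_conj_eq_0 (z : C) : Re (z * Cconj z)%C = 0 -> z = 0%C.
Proof.
  destruct z as [u v]; unfold Cmult, Cconj, Re; cbn [fst snd]; intros H.
  unfold RtoC; f_equal; nra.
Qed.

(* Kummer's transformation: both sides solve the same skew-Hermitian linear
   system, so the weighted squared norm of the difference is constant. *)
Lemma kummer_transformation (ch x : R) : ch <> 0 ->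
  kummer_X ch x = (Cexp (- zeta x) * U ch x)%C.
Proof.
  intros Hch.
  set (D := fun t => (kummer_X ch t - Cexp (- zeta t) * U ch t)%C).
  set (e := fun t => (kummer_Y ch t - Cexp (- zeta t) * xV ch t)%C).
  assert (HD : forall t, is_Cderive D t (- (ch ^ 2 / 4) * e t)%C).
  { intros t; eapply is_Cderive_eq.
    - apply is_Cderive_minus; [apply is_Cderive_kummer_X|].
      apply is_Cderive_mult; [apply is_Cderive_Cexp_opp_zeta | apply is_Cderive_U].
    - unfold e; ring. }
  assert (He : forall t, is_Cderive e t (D t - Ci * t * e t)%C).
  { intros t; eapply is_Cderive_eq.
    - apply is_Cderive_minus; [apply is_Cderive_kummer_Y|].
      apply is_Cderive_mult; [apply is_Cderive_Cexp_opp_zeta | apply is_Cderive_xV].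
    - unfold e, D; ring. }
  (* The weight chi^2/4 makes the cross terms of the two equations cancel in the real part, while
     the term in i t has zero real part. *)
  set (n := fun t => (D t * Cconj (D t) + ch ^ 2 / 4 * (e t * Cconj (e t)))%C).
  assert (Hn : forall t, is_derive (fun t => Re (n t)) t 0).
  { intros t.
    assert (Hc := is_Cderive_plus _ _ _ _ _
      (is_Cderive_mult _ _ _ _ _ (HD t) (is_Cderive_conj _ _ _ (HD t)))
      (is_Cderive_scal (ch ^ 2 / 4)%C _ _ _
        (is_Cderive_mult _ _ _ _ _ (He t) (is_Cderive_conj _ _ _ (He t))))).
    evar_last; [exact (proj1 Hc)|]; cbv beta; clear Hc.
    destruct (D t) as [d1 d2], (e t) as [e1 e2].
    rewrite <- !RtoC_pow, <- RtoC_div by lra.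
    unfold Cmult, Cminus, Cplus, Copp, Cconj, Ci, RtoC, Re; cbn [fst snd]; field. }
  assert (D0 : D 0 = 0%C /\ e 0 = 0%C).
  { unfold D, e, kummer_X, kummer_Y, xV.
    rewrite U_0, zero_pow2, !CPSeries_0, !kummer_coef_0, Cexp_opp_zeta.
    split; [|ring].
    replace (0 ^ 2 / 2) with 0 by field; rewrite cos_0, sin_0.
    unfold Cmult, Cminus, Cplus, Copp, RtoC; cbn [fst snd]; f_equal; ring. }
  assert (C0 : Re (n x) = Re (n 0)).
  { destruct (MVT_gen (fun t => Re (n t)) 0 x (fun _ => 0)) as [c [_ Hc]].
    - intros t _; apply Hn.
    - intros t _; apply derivable_continuous_pt, ex_derive_Reals_0; eexists; apply Hn.
    - lra. }
  apply Ceq_minus; change (D x = 0%C).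
  unfold n in C0; destruct D0 as [E1 E2]; rewrite E1, E2 in C0.
  apply Re_mult_conj_eq_0; revert C0; cbv beta.
  destruct (D x) as [d1 d2], (e x) as [e1 e2].
  rewrite <- !RtoC_pow, <- RtoC_div by lra.
  unfold Cmult, Cplus, Cconj, RtoC, Re; cbn [fst snd]; intros; nra.
Qed.

(** Because (1/2)_n / (3/2)_n = 1/(2n+1), x F is the primitive of the product of [U] and [kummer_X],
    which is the double series lemma at p = 0. *)
Lemma is_Cderive_calF (ch x : R) : ch <> 0 ->
  is_Cderive (fun t => t * calF ch t)%C x (Cexp (- zeta x) * (U ch x * U ch x))%C.
Proof.
  intros Hch.
  assert (H := is_Cderive_double_series 0 _ _ x
    (entire_kummer_half (mu ch) half_i) (entire_kummer_half (1 / 2 - mu ch) (- half_i))).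
  rewrite <- U_CPSeries in H; fold (kummer_X ch x) in H.
  rewrite kummer_transformation in H by exact Hch.
  eapply is_Cderive_eq; [|transitivity (RtoC x ^ 0 * (U ch x * (Cexp (- zeta x) * U ch x)))%C;
    [reflexivity | cbn [Cpow]; ring]].
  eapply is_Cderive_ext; [|exact H].
  intros t; cbn [Cpow]; rewrite Cmult_1_r; f_equal; unfold calF, kampe_de_feriet.
  apply CSeries_ext; intros j; apply CSeries_ext; intros k.
  rewrite opp_zeta_mul, zeta_mul, !Cpow_mult_l, Cpow_add_r, pochhammer_three_halves.
  unfold kummer_coef.
  assert (N := INR_S_neq0 (2 * (j + k))); rewrite <- Nat.add_1_r in N.
  field; repeat split;
    auto using INR_fact_C_neq0, pochhammer_half_neq0.
Qed.

Lemma Cconj_pochhammer (a : C) (n : nat) :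
  Cconj (pochhammer a n) = pochhammer (Cconj a) n.
Proof.
  induction n as [|n IH]; cbn [pochhammer].
  - apply injective_projections; cbn; ring.
  - rewrite Cmult_conj, Cplus_conj, IH; do 2 f_equal; apply injective_projections; cbn; ring.
Qed.

(** Conjugation sends [mu] to 1 - [mu] and [zeta] to its opposite, so the second factor behind
    [calG] is the conjugate of [U]. *)
Lemma U_conj (ch x : R) :
  Cconj (U ch x) = CPSeries (kummer_coef (1 - mu ch) (1 / 2) (- half_i)) (x ^ 2).
Proof.
  rewrite U_CPSeries, <- CPSeries_conj; apply CPSeries_ext; intros n; unfold kummer_coef.
  assert (Rc : forall r : R, Cconj r = r) by (intros r; apply injective_projections; cbn; ring).
  assert (Wc : Cconj half_i = (- half_i)%C).
  { unfold half_i, Ci, Cdiv, Cinv, Cmult, Copp, Cconj, RtoC; cbn [fst snd]; f_equal; field. }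
  assert (Mc : Cconj (mu ch) = (1 - mu ch)%C).
  { unfold mu; rewrite <- RtoC_pow.
    unfold Ci, Cdiv, Cinv, Cmult, Cminus, Cplus, Copp, Cconj, RtoC; cbn [fst snd]; f_equal; field. }
  rewrite !Cmult_conj, Cdiv_conj, !Cconj_pochhammer, Mc, RtoC_half, Rc.
  rewrite Cdiv_conj, Cpow_conj, Wc, Rc.
  all: auto using INR_fact_C_neq0, pochhammer_half_neq0.
Qed.

(** Here (1)_n / (2)_n = 1/(n+1) = 2/(2n+2): the double series lemma at p = 1, with the extra 2
    carried by the first factor. *)
Lemma is_Cderive_calG (ch x : R) :
  is_Cderive (fun t => RtoC t ^ 2 * calG ch t)%C x (2 * (xV ch x * Cconj (U ch x)))%C.
Proof.
  assert (H := is_Cderive_double_series 1 _ _ x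
    (entire_scal 2 _ (entire_kummer_three_halves (mu ch) half_i))
    (entire_kummer_half (1 - mu ch) (- half_i))).
  rewrite CPSeries_scal, <- V_CPSeries, <- U_conj in H by apply entire_kummer_three_halves.
  eapply is_Cderive_eq; [|transitivity (RtoC x ^ 1 * (2 * V ch x * Cconj (U ch x)))%C;
    [reflexivity | unfold xV; cbn [Cpow]; ring]].
  eapply is_Cderive_ext; [|exact H].
  intros t; cbv beta; f_equal; unfold calG, kampe_de_feriet.
  apply CSeries_ext; intros j; apply CSeries_ext; intros k.
  rewrite opp_zeta_mul, zeta_mul, !Cpow_mult_l, Cpow_add_r, pochhammer_two.
  unfold kummer_coef.
  replace (2 * (j + k) + 2)%nat with (2 * S (j + k))%nat by lia; rewrite mult_INR, RtoC_mult.
  assert (P : pochhammer 1 (j + k) <> 0%C) by (apply pochhammer_neq0; cbn; lra).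
  change (RtoC (INR 2)) with (RtoC 2).
  field; repeat split;
    auto using INR_fact_C_neq0, pochhammer_half_neq0, pochhammer_three_halves_neq0,
      INR_S_neq0, two_neq0.
Qed.

(** * Frenet frames in coordinates *)

(** The third argument is complex and only its real part is kept, so all three coordinates can be
    differentiated by the complex rules. *)
Definition vec3 (w z : C) : R3 := (Re w, Im w, Re z).

(** Links the derivative in the product normed module to scalar ones: projections are linear, and
    pairing preserves differentiability. *)
Lemma is_derive_R3 (f : R -> R3) (s : R) (l : R3) :
  is_derive f s l <->
  is_derive (fun t => px (f t)) s (px l) /\
  is_derive (fun t => py (f t)) s (py l) /\
  is_derive (fun t => pz (f t)) s (pz l).
Proof.
  split.
  - intros H.
    assert (P : forall (V W : NormedModule R_AbsRing) (g : R -> V) (L : V -> W) lg,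
      is_linear L -> is_derive g s lg -> is_derive (fun t => L (g t)) s (L lg)).
    { intros V W g L lg HL Hg.
      apply (filterdiff_ext_lin _ (fun y : R => L (scal y lg))).
      - exact (filterdiff_comp' g L s _ L Hg (filterdiff_linear _ HL)).
      - intros y; exact (linear_scal L HL y lg). }
    assert (H1 := P _ _ _ _ _ is_linear_fst H).
    exact (conj (P _ _ _ _ _ is_linear_fst H1)
      (conj (P _ _ _ _ _ is_linear_snd H1) (P _ _ _ _ _ is_linear_snd H))).
  - intros [H1 [H2 H3]].
    assert (P : forall (V W : NormedModule R_AbsRing) (g : R -> V) (h : R -> W) lg lh,
      is_derive g s lg -> is_derive h s lh ->
      is_derive (fun t => (g t, h t)) s (lg, lh)).
    { intros V W g h lg lh Hg Hh.
      apply (filterdiff_comp'_2 g h (fun x y => (x, y)) s _ _ (fun x y => (x, y)) Hg Hh).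
      apply (filterdiff_ext (fun x => x)); [now intros [? ?]|].
      apply (filterdiff_ext_lin _ (fun x => x)); [apply filterdiff_id | now intros [? ?]]. }
    apply (is_derive_ext (fun t => (px (f t), py (f t), pz (f t)))).
    { intros t; now destruct (f t) as [[? ?] ?]. }
    destruct l as [[l1 l2] l3]; exact (P _ _ _ _ _ _ (P _ _ _ _ _ _ H1 H2) H3).
Qed.

(** * Smoothness and uniqueness for the Frenet system *)

Inductive generated (B : (R -> R) -> Prop) : (R -> R) -> Prop :=
| generated_base f : B f -> generated B f
| generated_affine k l : generated B (fun s => k * s + l)
| generated_plus f g : generated B f -> generated B g -> generated B (fun s => f s + g s)
| generated_mult f g : generated B f -> generated B g -> generated B (fun s => f s * g s).

Lemma generated_derive (B : (R -> R) -> Prop) :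
  (forall f, B f -> exists g, generated B g /\ forall s, is_derive f s (g s)) ->
  forall f, generated B f -> exists g, generated B g /\ forall s, is_derive f s (g s).
Proof.
  intros HB f Hf.
  induction Hf as [f Hf | k l | f g Hf [f' [Gf Df]] Hg [g' [Gg Dg]]
    | f g Hf [f' [Gf Df]] Hg [g' [Gg Dg]]].
  - now apply HB.
  - exists (fun s => 0 * s + k); split; [apply generated_affine|].
    intros s; auto_derive; [trivial | ring].
  - exists (fun s => f' s + g' s); split; [now apply generated_plus|].
    intros s; exact (is_derive_plus _ _ _ _ _ (Df s) (Dg s)).
  - exists (fun s => f' s * g s + f s * g' s); split;
      [now apply generated_plus; apply generated_mult|].
    intros s; exact (is_derive_mult f g s _ _ (Df s) (Dg s) Rmult_comm).
Qed.

(** The class is stable under derivation once its generators have derivatives in it, so every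
    iterated derivative is again a member, hence differentiable. Affine functions are included
    because they are the coefficients of the clothoid system. *)
Lemma generated_smooth (B : (R -> R) -> Prop) :
  (forall f, B f -> exists g, generated B g /\ forall s, is_derive f s (g s)) ->
  forall f, generated B f -> smooth f.
Proof.
  intros HB f Hf.
  assert (D : forall n, exists g, generated B g /\ forall s, Derive_n f n s = g s).
  { induction n as [|n [g [Gg Eg]]]; [now exists f|].
    destruct (generated_derive B HB g Gg) as [g' [Gg' Dg']].
    exists g'; split; [exact Gg'|].
    intros s; simpl; rewrite (Derive_ext _ g) by exact Eg; now apply is_derive_unique. }
  intros [|n] s; [exact I|].
  destruct (D n) as [g [Gg Eg]], (generated_derive B HB g Gg) as [g' [_ Dg']].
  simpl; apply (ex_derive_ext g); [intros t; now rewrite Eg|].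
  eexists; apply Dg'.
Qed.

Definition frenet_coord (kappa tau t n b : R -> R) : Prop :=
  forall s,
    is_derive t s (kappa s * n s) /\
    is_derive n s (- kappa s * t s + tau s * b s) /\
    is_derive b s (- tau s * n s).

Lemma frenet_coord_smooth (a b c d : R) (x t n bn : R -> R) :
  frenet_coord (fun s => c * s + d) (fun s => a * s + b) t n bn ->
  (forall s, is_derive x s (t s)) ->
  smooth x /\ smooth t /\ smooth n /\ smooth bn.
Proof.
  intros H Hx.
  set (B := fun f => f = x \/ f = t \/ f = n \/ f = bn).
  assert (Bt : generated B t) by (constructor; unfold B; tauto).
  assert (Bn : generated B n) by (constructor; unfold B; tauto).
  assert (Bb : generated B bn) by (constructor; unfold B; tauto).
  assert (HB : forall f, B f -> exists g, generated B g /\ forall s, is_derive f s (g s)).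
  { intros f [->| [->| [->| ->]]].
    - exists t; split; [exact Bt | exact Hx].
    - exists (fun s => (c * s + d) * n s); split;
        [|intros s; exact (proj1 (H s))].
      apply generated_mult; [apply generated_affine | exact Bn].
    - exists (fun s => (- c * s + - d) * t s + (a * s + b) * bn s); split.
      + apply generated_plus; apply generated_mult; try apply generated_affine; assumption.
      + intros s; evar_last; [exact (proj1 (proj2 (H s))) | cbv beta; ring].
    - exists (fun s => (- a * s + - b) * n s); split.
      + apply generated_mult; [apply generated_affine | exact Bn].
      + intros s; evar_last; [exact (proj2 (proj2 (H s))) | cbv beta; ring]. }
  repeat split; apply (generated_smooth B HB); try assumption.
  constructor; unfold B; tauto.
Qed.

Lemma derive_0_const (f : R -> R) (s t : R) : (forall u, is_derive f u 0) -> f s = f t.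
Proof.
  intros H.
  destruct (MVT_gen f t s (fun _ => 0)) as [u [_ Hu]].
  - intros v _; apply H.
  - intros v _; apply derivable_continuous_pt, ex_derive_Reals_0; eexists; apply H.
  - lra.
Qed.

(** Skew-symmetry keeps the squared distance of two solutions constant, so agreement at [s0]
    propagates without any Lipschitz estimate. *)
Lemma frenet_coord_unique (kappa tau t1 n1 b1 t2 n2 b2 : R -> R) (s0 : R) :
  frenet_coord kappa tau t1 n1 b1 -> frenet_coord kappa tau t2 n2 b2 ->
  t1 s0 = t2 s0 -> n1 s0 = n2 s0 -> b1 s0 = b2 s0 ->
  forall s, t1 s = t2 s /\ n1 s = n2 s /\ b1 s = b2 s.
Proof.
  intros H1 H2 Et En Eb s.
  set (e := fun s => (t1 s - t2 s) ^ 2 + (n1 s - n2 s) ^ 2 + (b1 s - b2 s) ^ 2).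
  assert (He : e s = e s0).
  { apply derive_0_const; intros u.
    destruct (H1 u) as [T1 [N1 B1]], (H2 u) as [T2 [N2 B2]].
    assert (Sq : forall (f g : R -> R) (l m : R), is_derive f u l -> is_derive g u m ->
      is_derive (fun s => (f s - g s) ^ 2) u (2 * (f u - g u) * (l - m))).
    { intros f g l m Hf Hg; evar_last.
      - exact (is_derive_pow _ 2 _ _ (is_derive_minus _ _ _ _ _ Hf Hg)).
      - unfold minus, plus, opp; simpl; ring. }
    evar_last.
    - exact (is_derive_plus _ _ _ _ _ (is_derive_plus _ _ _ _ _
        (Sq _ _ _ _ T1 T2) (Sq _ _ _ _ N1 N2)) (Sq _ _ _ _ B1 B2)).
    - unfold plus; simpl; ring. }
  unfold e in He; rewrite Et, En, Eb in He.
  assert (P1 := pow2_ge_0 (t1 s - t2 s)).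
  assert (P2 := pow2_ge_0 (n1 s - n2 s)).
  assert (P3 := pow2_ge_0 (b1 s - b2 s)).
  repeat split; apply Rminus_diag_uniq, Rsqr_0_uniq; rewrite Rsqr_pow2; lra.
Qed.

Definition frenet_frame (kappa tau : R -> R) (r T N B : R -> R3) : Prop :=
  forall s : R,
    positive_orthonormal (T s) (N s) (B s) /\
    is_derive r s (T s) /\
    is_derive T s (scal (kappa s) (N s)) /\
    is_derive N s (plus (scal (- kappa s) (T s)) (scal (tau s) (B s))) /\
    is_derive B s (scal (- tau s) (N s)).

Lemma frenet_frame_coord (kappa tau : R -> R) (r T N B : R -> R3) :
  frenet_frame kappa tau r T N B <->
  (forall s, positive_orthonormal (T s) (N s) (B s)) /\
  forall h : R3 -> R, h = px \/ h = py \/ h = pz ->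
    frenet_coord kappa tau (fun s => h (T s)) (fun s => h (N s)) (fun s => h (B s)) /\
    forall s, is_derive (fun s => h (r s)) s (h (T s)).
Proof.
  split.
  - intros H; split; [intros s; apply H|].
    intros h Hh; split; intros s; destruct (H s) as [_ [Hr [HT [HN HB]]]];
      apply is_derive_R3 in Hr, HT, HN, HB;
      destruct Hr as [? [? ?]], HT as [Tx [Ty Tz]], HN as [Nx [Ny Nz]], HB as [Bx [By Bz]];
      destruct Hh as [-> | [-> | ->]]; try assumption.
    + exact (conj Tx (conj Nx Bx)).
    + exact (conj Ty (conj Ny By)).
    + exact (conj Tz (conj Nz Bz)).
  - intros [Ho H] s.
    destruct (H px) as [X Xr]; [tauto|].
    destruct (H py) as [Y Yr]; [tauto|].
    destruct (H pz) as [Z Zr]; [tauto|].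
    destruct (X s) as [? [? ?]], (Y s) as [? [? ?]], (Z s) as [? [? ?]].
    split; [apply Ho|].
    split; [|split; [|split]]; apply is_derive_R3; (split; [|split]); auto.
Qed.

(** The smoothness clauses follow from the equations themselves, each derivative being a polynomial
    in s and the coordinates of the frame. *)
Lemma clothoid_iff_frame (a b c d : R) (q : R -> R3) :
  clothoid a b c d q <->
  exists T N B, frenet_frame (fun s => c * s + d) (fun s => a * s + b) q T N B.
Proof.
  split.
  - intros [_ [T [N [B [_ H]]]]]; now exists T, N, B.
  - intros [T [N [B H]]].
    destruct (proj1 (frenet_frame_coord _ _ _ _ _ _) H) as [_ K].
    assert (S : forall h, h = px \/ h = py \/ h = pz ->
      smooth (fun s => h (q s)) /\ smooth (fun s => h (T s)) /\
      smooth (fun s => h (N s)) /\ smooth (fun s => h (B s))).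
    { intros h Hh; destruct (K h Hh) as [Kf Kr].
      exact (frenet_coord_smooth _ _ _ _ _ _ _ _ Kf Kr). }
    destruct (S px) as [? [? [? ?]]]; [tauto|].
    destruct (S py) as [? [? [? ?]]]; [tauto|].
    destruct (S pz) as [? [? [? ?]]]; [tauto|].
    split; [now repeat split|].
    exists T, N, B; split; [now repeat split | exact H].
Qed.

(** * Rigid motions and rotations of frames *)

Lemma px_plus (x y : R3) : px (plus x y) = px x + px y.
Proof. reflexivity. Qed.
Lemma py_plus (x y : R3) : py (plus x y) = py x + py y.
Proof. reflexivity. Qed.
Lemma pz_plus (x y : R3) : pz (plus x y) = pz x + pz y.
Proof. reflexivity. Qed.
Lemma px_scal (k : R) (x : R3) : px (scal k x) = k * px x.
Proof. reflexivity. Qed.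
Lemma py_scal (k : R) (x : R3) : py (scal k x) = k * py x.
Proof. reflexivity. Qed.
Lemma pz_scal (k : R) (x : R3) : pz (scal k x) = k * pz x.
Proof. reflexivity. Qed.

Ltac R3_coords :=
  repeat rewrite ?px_plus, ?py_plus, ?pz_plus, ?px_scal, ?py_scal, ?pz_scal.

Definition rotation (u v w x : R3) : R3 :=
  plus (scal (px x) u) (plus (scal (py x) v) (scal (pz x) w)).

Lemma dot_rotation (u v w x y : R3) :
  positive_orthonormal u v w -> dot (rotation u v w x) (rotation u v w y) = dot x y.
Proof.
  intros [[Huu [Hvv Hww]] [[Huv [Huw Hvw]] _]].
  transitivity (px x * px y * dot u u + py x * py y * dot v v + pz x * pz y * dot w w
    + (px x * py y + py x * px y) * dot u v + (px x * pz y + pz x * px y) * dot u w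
    + (py x * pz y + pz x * py y) * dot v w).
  - unfold dot, rotation; R3_coords; ring.
  - rewrite Huu, Hvv, Hww, Huv, Huw, Hvw; unfold dot; ring.
Qed.

Lemma det3_rotation (u v w x y z : R3) :
  det3 (rotation u v w x) (rotation u v w y) (rotation u v w z) = det3 u v w * det3 x y z.
Proof.
  unfold det3, rotation; R3_coords; ring.
Qed.

(** A coordinate of a rotated vector is a fixed linear combination of the old coordinates, hence
    solves the same linear system. *)
Lemma frenet_frame_rigid (kappa tau : R -> R) (r T N B q : R -> R3) (p u v w : R3) :
  positive_orthonormal u v w ->
  frenet_frame kappa tau r T N B ->
  (forall s, q s = plus p (rotation u v w (r s))) ->
  frenet_frame kappa tau q (fun s => rotation u v w (T s))
    (fun s => rotation u v w (N s)) (fun s => rotation u v w (B s)).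
Proof.
  intros Ho H Hq.
  apply frenet_frame_coord; apply frenet_frame_coord in H; destruct H as [HO H].
  split.
  - intros s; destruct (HO s) as [[? [? ?]] [[? [? ?]] ?]]; unfold positive_orthonormal.
    rewrite !dot_rotation, det3_rotation by exact Ho.
    repeat split; try assumption; apply Rmult_lt_0_compat; [apply Ho | assumption].
  - destruct (H px) as [X Xr]; [tauto|].
    destruct (H py) as [Y Yr]; [tauto|].
    destruct (H pz) as [Z Zr]; [tauto|].
    intros h Hh.
    assert (L : forall x, h (rotation u v w x) = px x * h u + py x * h v + pz x * h w).
    { intros x; destruct Hh as [->| [->| ->]];
        unfold rotation; R3_coords; ring. }
    assert (D : forall (f : R -> R3) (s l1 l2 l3 : R),
      is_derive (fun s => px (f s)) s l1 -> is_derive (fun s => py (f s)) s l2 ->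
      is_derive (fun s => pz (f s)) s l3 ->
      is_derive (fun s => h (rotation u v w (f s))) s (l1 * h u + l2 * h v + l3 * h w)).
    { intros f s l1 l2 l3 D1 D2 D3.
      apply (is_derive_ext (fun s => px (f s) * h u + py (f s) * h v + pz (f s) * h w));
        [intros t; now rewrite L|].
      exact (is_derive_plus _ _ _ _ _ (is_derive_plus _ _ _ _ _
        (is_derive_scal_l _ _ _ (h u) D1) (is_derive_scal_l _ _ _ (h v) D2))
        (is_derive_scal_l _ _ _ (h w) D3)). }
    split.
    + intros s; destruct (X s) as [? [? ?]], (Y s) as [? [? ?]], (Z s) as [? [? ?]].
      (split; [|split]); (evar_last; [apply D; eassumption | cbv beta; rewrite ?L; ring]).
    + intros s.
      apply (is_derive_ext (fun s => h p + h (rotation u v w (r s)))).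
      { intros t; rewrite Hq; destruct Hh as [->| [->| ->]]; reflexivity. }
      evar_last.
      * apply (is_derive_plus (fun _ => h p)); [apply is_derive_const | now apply D].
      * rewrite L; unfold plus, zero; simpl; ring.
Qed.

Lemma R3_eq (x y : R3) : px x = px y -> py x = py y -> pz x = pz y -> x = y.
Proof.
  destruct x as [[? ?] ?], y as [[? ?] ?]; unfold px, py, pz; simpl; congruence.
Qed.

(** There are two base points because frames will be matched where xi vanishes and positions at
    parameter 0. *)
Lemma frenet_frame_unique (kappa tau : R -> R) (r1 T1 N1 B1 r2 T2 N2 B2 : R -> R3) (s0 s1 : R) :
  frenet_frame kappa tau r1 T1 N1 B1 -> frenet_frame kappa tau r2 T2 N2 B2 ->
  T1 s0 = T2 s0 -> N1 s0 = N2 s0 -> B1 s0 = B2 s0 -> r1 s1 = r2 s1 ->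
  forall s, r1 s = r2 s.
Proof.
  intros H1 H2 ET EN EB Er s.
  apply frenet_frame_coord in H1, H2; destruct H1 as [_ H1], H2 as [_ H2].
  assert (K : forall h, h = px \/ h = py \/ h = pz -> h (r1 s) = h (r2 s)).
  { intros h Hh; destruct (H1 h Hh) as [F1 D1], (H2 h Hh) as [F2 D2].
    assert (E := frenet_coord_unique _ _ _ _ _ _ _ _ s0 F1 F2
      (f_equal h ET) (f_equal h EN) (f_equal h EB)).
    apply Rminus_diag_uniq.
    rewrite (derive_0_const (fun s => h (r1 s) - h (r2 s)) s s1); [rewrite Er; ring|].
    intros t; evar_last; [exact (is_derive_minus _ _ _ _ _ (D1 t) (D2 t))|].
    simpl; rewrite (proj1 (E t)); unfold minus, plus, opp; simpl; ring. }
  apply R3_eq; apply K; tauto.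
Qed.

(** Together with [turn_snd], the rotation with cosine [al] and sine [be] in the plane of x and y.
    It takes (A, C) to (T, B). *)
Definition turn_fst (al be : R) (x y : R3) : R3 := plus (scal al x) (scal (- be) y).
Definition turn_snd (al be : R) (x y : R3) : R3 := plus (scal be x) (scal al y).

Lemma positive_orthonormal_turn (al be : R) (x n y : R3) :
  al ^ 2 + be ^ 2 = 1 -> positive_orthonormal x n y ->
  positive_orthonormal (turn_fst al be x y) n (turn_snd al be x y).
Proof.
  intros E [[Hxx [Hnn Hyy]] [[Hxn [Hxy Hny]] Hd]].
  assert (E1 : dot (turn_fst al be x y) (turn_fst al be x y) =
    al ^ 2 * dot x x - 2 * al * be * dot x y + be ^ 2 * dot y y).
  { unfold dot, turn_fst; R3_coords; ring. }
  assert (E2 : dot (turn_snd al be x y) (turn_snd al be x y) =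
    be ^ 2 * dot x x + 2 * al * be * dot x y + al ^ 2 * dot y y).
  { unfold dot, turn_snd; R3_coords; ring. }
  assert (E3 : dot (turn_fst al be x y) n = al * dot x n - be * dot n y).
  { unfold dot, turn_fst; R3_coords; ring. }
  assert (E4 : dot n (turn_snd al be x y) = be * dot x n + al * dot n y).
  { unfold dot, turn_snd; R3_coords; ring. }
  assert (E5 : dot (turn_fst al be x y) (turn_snd al be x y) =
    al * be * (dot x x - dot y y) + (al ^ 2 - be ^ 2) * dot x y).
  { unfold dot, turn_fst, turn_snd; R3_coords; ring. }
  assert (E6 : det3 (turn_fst al be x y) n (turn_snd al be x y) =
    (al ^ 2 + be ^ 2) * det3 x n y).
  { unfold det3, turn_fst, turn_snd; R3_coords; ring. }
  unfold positive_orthonormal; rewrite E1, E2, E3, E4, E5, E6, Hxx, Hnn, Hyy, Hxn, Hxy, Hny.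
  repeat split; try lra; nra.
Qed.

(* Hopf frame of a unit spinor [(p1 + i p2, q1 + i q2)]. *)
Lemma spinor_frame (p1 p2 q1 q2 : R) :
  p1 ^ 2 + p2 ^ 2 + q1 ^ 2 + q2 ^ 2 = 1 ->
  positive_orthonormal
    (2 * (p1 * q2 + p2 * q1), - 2 * (p1 * q1 - p2 * q2), p1 ^ 2 + p2 ^ 2 - q1 ^ 2 - q2 ^ 2)
    (- 2 * (p1 * p2 - q1 * q2), p1 ^ 2 - p2 ^ 2 - q1 ^ 2 + q2 ^ 2, 2 * (p1 * q1 + p2 * q2))
    (- (p1 ^ 2 - p2 ^ 2 + q1 ^ 2 - q2 ^ 2), - 2 * (p1 * p2 + q1 * q2), 2 * (p1 * q2 - p2 * q1)).
Proof.
  set (m := p1 ^ 2 + p2 ^ 2 + q1 ^ 2 + q2 ^ 2); intros Hm.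
  unfold positive_orthonormal, dot, det3, px, py, pz; cbn [fst snd].
  (* For an arbitrary spinor the three squared lengths are m^2 and the determinant is m^3. *)
  assert (E2 : m ^ 2 = 1) by (rewrite Hm; ring).
  assert (E3 : m ^ 3 = 1) by (rewrite Hm; ring).
  split; [|split].
  - split; [|split]; (transitivity (m ^ 2); [unfold m; ring | exact E2]).
  - split; [|split]; ring.
  - match goal with |- 0 < ?e => replace e with (m ^ 3) by (unfold m; ring) end.
    rewrite E3; lra.
Qed.

(** * The frame built from U and V *)

Definition spinor_norm (ch x : R) : C :=
  (U ch x * Cconj (U ch x) + ch ^ 2 / 4 * (xV ch x * Cconj (xV ch x)))%C.

Lemma spinor_norm_1 (ch x : R) : Re (spinor_norm ch x) = 1.
Proof.
  transitivity (Re (spinor_norm ch 0)).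
  - apply (derive_0_const (fun t => Re (spinor_norm ch t))); intros t.
    assert (HU := is_Cderive_U ch t); assert (HV := is_Cderive_xV ch t).
    assert (Hc := is_Cderive_plus _ _ _ _ _
      (is_Cderive_mult _ _ _ _ _ HU (is_Cderive_conj _ _ _ HU))
      (is_Cderive_scal (ch ^ 2 / 4)%C _ _ _
        (is_Cderive_mult _ _ _ _ _ HV (is_Cderive_conj _ _ _ HV)))).
    evar_last; [exact (proj1 Hc)|]; cbv beta; clear Hc HU HV.
    destruct (U ch t) as [u1 u2], (xV ch t) as [v1 v2].
    rewrite <- !RtoC_pow, <- RtoC_div by lra.
    unfold Cmult, Cminus, Cplus, Copp, Cconj, Ci, RtoC, Re; cbn [fst snd]; field.
  - unfold spinor_norm, xV; rewrite U_0.
    unfold Cmult, Cplus, Cconj, RtoC, Re; cbn [fst snd]; ring.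
Qed.

(** With p = e^(-zeta/2) [U] and q = (chi/2) e^(-zeta/2) [xV], the frame pairs x + i y with z as
    follows: A = (-2i p q, |p|^2 - |q|^2), N = (i (p^2 - q^2), 2 Re(conj(p) q)), C = (-(p^2 + q^2),
    2 Im(conj(p) q)). The phase survives as e^(-zeta) in x + i y and cancels in z. *)
Definition frame_A (ch x : R) : R3 :=
  vec3 (- (Ci * ch * (Cexp (- zeta x) * (U ch x * xV ch x))))%C
    (U ch x * Cconj (U ch x) - ch ^ 2 / 4 * (xV ch x * Cconj (xV ch x)))%C.

Definition frame_N (ch x : R) : R3 :=
  vec3 (Ci * (Cexp (- zeta x) * (U ch x * U ch x - ch ^ 2 / 4 * (xV ch x * xV ch x))))%C
    (ch * (Cconj (U ch x) * xV ch x))%C.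

Definition frame_C (ch x : R) : R3 :=
  vec3 (- (Cexp (- zeta x) * (U ch x * U ch x + ch ^ 2 / 4 * (xV ch x * xV ch x))))%C
    (- (Ci * ch * (Cconj (U ch x) * xV ch x)))%C.

Lemma R3_eq_tuple (x1 x2 x3 y1 y2 y3 : R) :
  x1 = y1 -> x2 = y2 -> x3 = y3 -> (x1, x2, x3) = (y1, y2, y3) :> R3.
Proof. congruence. Qed.

Lemma frame_orthonormal (ch x : R) :
  positive_orthonormal (frame_A ch x) (frame_N ch x) (frame_C ch x).
Proof.
  assert (HS := spinor_norm_1 ch x); revert HS.
  unfold spinor_norm, frame_A, frame_N, frame_C, vec3.
  rewrite Cexp_opp_zeta.
  (* Halving the angle writes e^(-zeta) as a square, so that it can be shared between the two spinor
     factors of each product. *)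
  replace (x ^ 2 / 2) with (2 * (x ^ 2 / 4)) by field.
  rewrite cos_2a, sin_2a.
  assert (Hcs := sin2_cos2 (x ^ 2 / 4)); unfold Rsqr in Hcs.
  set (c := cos (x ^ 2 / 4)) in *; set (s := sin (x ^ 2 / 4)) in *.
  destruct (U ch x) as [u1 u2], (xV ch x) as [v1 v2].
  rewrite <- !RtoC_pow, <- RtoC_div by lra.
  unfold Cmult, Cminus, Cplus, Copp, Cconj, Ci, RtoC, Re, Im; cbn [fst snd]; intros HS.
  set (p1 := c * u1 + s * u2); set (p2 := c * u2 - s * u1).
  set (q1 := ch / 2 * (c * v1 + s * v2)); set (q2 := ch / 2 * (c * v2 - s * v1)).
  (* The common phase drops out of these four sesquilinear expressions. *)
  assert (N1 : p1 ^ 2 + p2 ^ 2 = u1 ^ 2 + u2 ^ 2).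
  { transitivity ((s * s + c * c) * (u1 ^ 2 + u2 ^ 2)); [unfold p1, p2; ring | rewrite Hcs; ring]. }
  assert (N2 : q1 ^ 2 + q2 ^ 2 = ch ^ 2 / 4 * (v1 ^ 2 + v2 ^ 2)).
  { transitivity ((s * s + c * c) * (ch ^ 2 / 4 * (v1 ^ 2 + v2 ^ 2)));
      [unfold q1, q2; field | rewrite Hcs; ring]. }
  assert (N3 : p1 * q1 + p2 * q2 = ch / 2 * (u1 * v1 + u2 * v2)).
  { transitivity ((s * s + c * c) * (ch / 2 * (u1 * v1 + u2 * v2)));
      [unfold p1, p2, q1, q2; field | rewrite Hcs; ring]. }
  assert (N4 : p1 * q2 - p2 * q1 = ch / 2 * (u1 * v2 - u2 * v1)).
  { transitivity ((s * s + c * c) * (ch / 2 * (u1 * v2 - u2 * v1)));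
      [unfold p1, p2, q1, q2; field | rewrite Hcs; ring]. }
  match goal with |- positive_orthonormal ?a ?b ?d =>
    replace a with ((2 * (p1 * q2 + p2 * q1), - 2 * (p1 * q1 - p2 * q2),
      p1 ^ 2 + p2 ^ 2 - q1 ^ 2 - q2 ^ 2) : R3);
    [replace b with ((- 2 * (p1 * p2 - q1 * q2), p1 ^ 2 - p2 ^ 2 - q1 ^ 2 + q2 ^ 2,
      2 * (p1 * q1 + p2 * q2)) : R3);
    [replace d with ((- (p1 ^ 2 - p2 ^ 2 + q1 ^ 2 - q2 ^ 2), - 2 * (p1 * p2 + q1 * q2),
      2 * (p1 * q2 - p2 * q1)) : R3)|]|]
  end.
  - apply spinor_frame; lra.
  - apply R3_eq_tuple; [unfold p1, p2, q1, q2; field | unfold p1, p2, q1, q2; field|].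
    rewrite N4; field.
  - apply R3_eq_tuple; [unfold p1, p2, q1, q2; field | unfold p1, p2, q1, q2; field|].
    rewrite N3; field.
  - apply R3_eq_tuple; [unfold p1, p2, q1, q2; field | unfold p1, p2, q1, q2; field|].
    transitivity (p1 ^ 2 + p2 ^ 2 - (q1 ^ 2 + q2 ^ 2)); [ring|].
    rewrite N1, N2; field.
Qed.

Lemma is_derive_vec3 (f g : R -> C) (x : R) (l m : C) :
  is_Cderive f x l -> is_Cderive g x m ->
  is_derive (fun t => vec3 (f t) (g t)) x (vec3 l m).
Proof. intros [F1 F2] [G _]; apply is_derive_R3; now split. Qed.

Ltac Cderive :=
  lazymatch goal with
  | |- is_Cderive (fun _ => ?z) _ _ => apply (is_Cderive_const z)
  | |- is_Cderive (fun t => RtoC t) _ _ => apply is_Cderive_id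
  | |- is_Cderive (fun t => U ?ch t) _ _ => exact (is_Cderive_U ch _)
  | |- is_Cderive (fun t => xV ?ch t) _ _ => exact (is_Cderive_xV ch _)
  | |- is_Cderive (fun t => Cexp (- zeta t)) _ _ => apply is_Cderive_Cexp_opp_zeta
  | |- is_Cderive (fun t => Cconj (@?f t)) _ _ => apply (is_Cderive_conj f); Cderive
  | |- is_Cderive (fun t => - @?f t)%C _ _ => apply (is_Cderive_opp f); Cderive
  | |- is_Cderive (fun t => @?f t - @?g t)%C _ _ => apply (is_Cderive_minus f g); Cderive
  | |- is_Cderive (fun t => @?f t + @?g t)%C _ _ => apply (is_Cderive_plus f g); Cderive
  | |- is_Cderive (fun t => @?f t * @?g t)%C _ _ => apply (is_Cderive_mult f g); Cderive
  | |- _ => eassumption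
  end.

Lemma vec3_eq (w z w' z' : C) : w = w' -> Re z = Re z' -> vec3 w z = vec3 w' z'.
Proof. unfold vec3; congruence. Qed.

Lemma vec3_scal (k : R) (w z : C) : scal k (vec3 w z) = vec3 (k * w)%C (k * z)%C.
Proof.
  apply R3_eq; R3_coords; unfold vec3, px, py, pz; cbn [fst snd].
  - now rewrite re_scal_l.
  - now rewrite im_scal_l.
  - now rewrite re_scal_l.
Qed.

Lemma vec3_plus (w z w' z' : C) : plus (vec3 w z) (vec3 w' z') = vec3 (w + w')%C (z + z')%C.
Proof. reflexivity. Qed.

Lemma quarter_sqr (ch : R) : (RtoC ch ^ 2 / 4)%C = RtoC (ch ^ 2 / 4).
Proof. now rewrite RtoC_div, RtoC_pow by lra. Qed.

Ltac C_coords :=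
  unfold Cmult, Cminus, Cplus, Copp, Cconj, Ci, RtoC, Re, Im; cbn [fst snd].

Lemma is_derive_frame_A (ch x : R) :
  is_derive (fun t => frame_A ch t) x (scal (- ch) (frame_N ch x)).
Proof.
  evar_last; [unfold frame_A; apply is_derive_vec3; Cderive|].
  unfold frame_N; rewrite vec3_scal, RtoC_opp; apply vec3_eq; [cbv beta; ring|].
  rewrite quarter_sqr; destruct (U ch x), (xV ch x); C_coords; field.
Qed.

Lemma is_derive_frame_N (ch x : R) :
  is_derive (fun t => frame_N ch t) x (plus (scal ch (frame_A ch x)) (scal x (frame_C ch x))).
Proof.
  evar_last; [unfold frame_N; apply is_derive_vec3; Cderive|].
  unfold frame_A, frame_C; rewrite !vec3_scal, vec3_plus; apply vec3_eq.
  - transitivity (Ci * Ci * (x * (Cexp (- zeta x) *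
      (U ch x * U ch x + ch ^ 2 / 4 * (xV ch x * xV ch x))))
      - ch ^ 2 * (Ci * (Cexp (- zeta x) * (U ch x * xV ch x))))%C.
    + cbv beta; field; apply RtoC_neq0; lra.
    + rewrite Ci_sqr; ring.
  - rewrite quarter_sqr; destruct (U ch x), (xV ch x); C_coords; field.
Qed.

Lemma is_derive_frame_C (ch x : R) :
  is_derive (fun t => frame_C ch t) x (scal (- x) (frame_N ch x)).
Proof.
  evar_last; [unfold frame_C; apply is_derive_vec3; Cderive|].
  unfold frame_N; rewrite vec3_scal, RtoC_opp; apply vec3_eq; [cbv beta; ring|].
  rewrite quarter_sqr; destruct (U ch x), (xV ch x); C_coords; field.
Qed.

Lemma frame_0 (ch : R) :
  frame_A ch 0 = (0, 0, 1) /\ frame_N ch 0 = (0, 1, 0) /\ frame_C ch 0 = (-1, 0, 0).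
Proof.
  unfold frame_A, frame_N, frame_C, xV; rewrite U_0, Cexp_opp_zeta.
  replace (0 ^ 2 / 2) with 0 by field; rewrite cos_0, sin_0, !Cmult_0_l, quarter_sqr.
  split; [|split]; apply R3_eq_tuple; C_coords; ring.
Qed.

Definition curve_xy (a c ch x : R) : C :=
  (2 * c * x * calF ch x
   + Cexp (- zeta x)
     * (a * ch * U ch x ^ 2
        + a * ch ^ 3 * x ^ 2 / 4 * V ch x ^ 2
        - (c * x + Ci * a * ch * x ^ 2) * (U ch x * V ch x)))%C.

Definition curve_z (a c ch x : R) : R :=
  (Re (Ci * c * ch * x ^ 2 / 2 * calG ch x)%C
   + a * x * (2 * Cmod (U ch x) ^ 2 - 1
              - ch ^ 2 * Im (Cconj (U ch x) * V ch x)%C))%R.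

(** The x + i y part is an identity in [U] and [xV]; the z part also needs the conserved norm,
    because of the constant -1 in the bracket. *)
Lemma is_derive_curve (a c ch x : R) : ch <> 0 ->
  is_derive (fun t => (Re (curve_xy a c ch t), Im (curve_xy a c ch t), curve_z a c ch t) : R3) x
    (plus (scal a (frame_A ch x)) (scal (- c) (frame_C ch x))).
Proof.
  intros Hch.
  set (F := fun t : R => (t * calF ch t)%C); set (G := fun t : R => (RtoC t ^ 2 * calG ch t)%C).
  assert (HF : is_Cderive (fun t => F t) x (Cexp (- zeta x) * (U ch x * U ch x))%C)
    by now apply is_Cderive_calF.
  assert (HG : is_Cderive (fun t => G t) x (2 * (xV ch x * Cconj (U ch x)))%C)
    by apply is_Cderive_calG.
  (* The bracket is rewritten through x F, x^2 G and [xV], whose derivatives are known, with |U|^2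
     as a product of conjugates and -Im(w) as Re(i w). *)
  apply (is_derive_ext (fun t => vec3
    (2 * c * F t + Cexp (- zeta t) * (a * ch * (U ch t * U ch t)
       + a * ch * (ch ^ 2 / 4) * (xV ch t * xV ch t)
       - (c + Ci * a * ch * t) * (U ch t * xV ch t)))
    (Ci * c * ch * / 2 * G t + a * t * (2 * (U ch t * Cconj (U ch t)) - 1)
       + Ci * a * ch ^ 2 * (Cconj (U ch t) * xV ch t)))).
  { intros t; unfold vec3; apply R3_eq_tuple.
    - f_equal; unfold F, curve_xy, xV; field; apply RtoC_neq0; lra.
    - f_equal; unfold F, curve_xy, xV; field; apply RtoC_neq0; lra.
    - unfold curve_z; rewrite Cmod2_alt, re_plus, re_plus.
      replace (Ci * c * ch * / 2 * G t)%C with (Ci * c * ch * t ^ 2 / 2 * calG ch t)%C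
        by (unfold G; field; apply RtoC_neq0; lra).
      rewrite Rplus_assoc; f_equal.
      unfold xV; destruct (U ch t) as [u1 u2], (V ch t) as [v1 v2].
      rewrite <- RtoC_pow; C_coords; ring. }
  clearbody F G; evar_last; [apply is_derive_vec3; Cderive|].
  unfold frame_A, frame_C; rewrite !vec3_scal, vec3_plus, RtoC_opp; apply vec3_eq.
  - cbv beta; ring.
  - set (du := (Ci * x * U ch x - ch ^ 2 / 4 * xV ch x)%C).
    transitivity (Re (Ci * c * ch * (xV ch x * Cconj (U ch x))
      + a * (2 * (U ch x * Cconj (U ch x)) - 1)
      + 2 * (a * x) * (du * Cconj (U ch x) + U ch x * Cconj du)
      + Ci * a * ch ^ 2 * (Cconj du * xV ch x + Cconj (U ch x) * U ch x))%C).
    { f_equal; cbv beta; fold du; field; apply RtoC_neq0; lra. }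
    unfold du; rewrite !quarter_sqr, <- !RtoC_pow.
    assert (HS := spinor_norm_1 ch x); unfold spinor_norm in HS.
    rewrite quarter_sqr in HS; revert HS.
    destruct (U ch x) as [u1 u2], (xV ch x) as [v1 v2]; C_coords; intros HS.
    (* The two sides differ by exactly a times the defect of the spinor norm from 1. *)
    match type of HS with ?n = 1 => apply Rminus_diag_uniq; transitivity (a * (n - 1)) end.
    + field.
    + rewrite HS; ring.
Qed.

(** * The clothoid *)

Lemma rho_pos (a c : R) : 0 < a ^ 2 + c ^ 2 -> 0 < rho a c.
Proof. apply sqrt_lt_R0. Qed.

Lemma rho_sqr (a c : R) : rho a c ^ 2 = a ^ 2 + c ^ 2.
Proof. apply pow2_sqrt; nra. Qed.

Lemma Rpower_three_halves (y : R) : 0 < y -> Rpower y (3 / 2) = y * sqrt y.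
Proof.
  intros Hy; replace (3 / 2) with (1 + / 2) by field.
  now rewrite Rpower_plus, Rpower_1, Rpower_sqrt.
Qed.

Lemma is_derive_xi (a b c d : R) (f : R -> R) (l s : R) :
  is_derive f (xi a b c d s) l ->
  is_derive (fun s => f (xi a b c d s)) s (sqrt (rho a c) * l).
Proof.
  intros H; apply (is_derive_comp f (xi a b c d) s l (sqrt (rho a c)) H).
  unfold xi; auto_derive; [trivial | ring].
Qed.

(** The chain rule brings in the factor sqrt(rho). Multiplied by it, both xi and chi lose their
    square roots, so the Frenet coefficients can be checked as rational expressions in rho. *)
Lemma sqrt_rho_mul_xi (a b c d s : R) : 0 < a ^ 2 + c ^ 2 ->
  sqrt (rho a c) * xi a b c d s = (rho a c ^ 2 * s + a * b + c * d) / rho a c.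
Proof.
  intros H; assert (P := rho_pos a c H); unfold xi.
  rewrite <- Rmult_assoc, sqrt_sqrt by lra; field; lra.
Qed.

Lemma sqrt_rho_mul_chi (a b c d : R) : 0 < a ^ 2 + c ^ 2 ->
  sqrt (rho a c) * chi a b c d = (b * c - a * d) / rho a c.
Proof.
  intros H; assert (P := rho_pos a c H); unfold chi, Delta_abcd.
  rewrite Rpower_three_halves by exact P.
  assert (Q := sqrt_lt_R0 _ P); field; lra.
Qed.

(** The definitions of xi and chi solve sqrt(rho) (c xi - a chi) = rho (c s + d) and sqrt(rho) (a xi
    + c chi) = rho (a s + b); the mixed terms in a b c and a c d cancel, leaving a^2 + c^2 = rho^2
    as a factor. *)
Lemma frenet_coord_of_darboux (a b c d : R) (A N C : R -> R) :
  0 < a ^ 2 + c ^ 2 ->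
  (forall x, is_derive A x (- chi a b c d * N x)) ->
  (forall x, is_derive N x (chi a b c d * A x + x * C x)) ->
  (forall x, is_derive C x (- x * N x)) ->
  frenet_coord (fun s => c * s + d) (fun s => a * s + b)
    (fun s => a / rho a c * A (xi a b c d s) + - (c / rho a c) * C (xi a b c d s))
    (fun s => N (xi a b c d s))
    (fun s => c / rho a c * A (xi a b c d s) + a / rho a c * C (xi a b c d s)).
Proof.
  intros H HA HN HC s.
  assert (P := rho_pos a c H); assert (E := rho_sqr a c).
  assert (X := sqrt_rho_mul_xi a b c d s H); assert (Y := sqrt_rho_mul_chi a b c d H).
  assert (DA := is_derive_xi a b c d _ _ s (HA _)).
  assert (DN := is_derive_xi a b c d _ _ s (HN _)).
  assert (DC := is_derive_xi a b c d _ _ s (HC _)).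
  set (x := xi a b c d s) in *; set (k := chi a b c d) in *.
  set (r := rho a c) in *; set (w := sqrt r) in *.
  split; [|split].
  - evar_last; [exact (is_derive_plus _ _ _ _ _
      (is_derive_scal _ _ (a / r) _ DA) (is_derive_scal _ _ (- (c / r)) _ DC))|].
    transitivity ((- a * (w * k) + c * (w * x)) / r * N x);
      [unfold plus; simpl; field; lra|].
    rewrite X, Y.
    transitivity ((r ^ 2 * c * s + (a ^ 2 + c ^ 2) * d) / r ^ 2 * N x); [field; lra|].
    rewrite <- E; field; lra.
  - evar_last; [exact DN|].
    transitivity (w * k * A x + w * x * C x); [ring|].
    rewrite X, Y, E; field; lra.
  - evar_last; [exact (is_derive_plus _ _ _ _ _
      (is_derive_scal _ _ (c / r) _ DA) (is_derive_scal _ _ (a / r) _ DC))|].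
    transitivity ((- c * (w * k) - a * (w * x)) / r * N x);
      [unfold plus; simpl; field; lra|].
    rewrite X, Y.
    transitivity (- ((r ^ 2 * a * s + (a ^ 2 + c ^ 2) * b) / r ^ 2) * N x); [field; lra|].
    rewrite <- E; field; lra.
Qed.

Definition clothoid_curve (a b c d s : R) : R3 :=
  let p := fun x => (Re (curve_xy a c (chi a b c d) x), Im (curve_xy a c (chi a b c d) x),
    curve_z a c (chi a b c d) x) : R3 in
  scal (Rpower (rho a c) (- (3 / 2))) (minus (p (xi a b c d s)) (p (xi a b c d 0))).

Definition frame_T (a b c d s : R) : R3 :=
  turn_fst (a / rho a c) (c / rho a c)
    (frame_A (chi a b c d) (xi a b c d s)) (frame_C (chi a b c d) (xi a b c d s)).

Definition frame_B (a b c d s : R) : R3 :=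
  turn_snd (a / rho a c) (c / rho a c)
    (frame_A (chi a b c d) (xi a b c d s)) (frame_C (chi a b c d) (xi a b c d s)).

Lemma clothoid_curve_frame (a b c d : R) :
  0 < a ^ 2 + c ^ 2 -> Delta_abcd a b c d <> 0 ->
  frenet_frame (fun s => c * s + d) (fun s => a * s + b) (clothoid_curve a b c d)
    (frame_T a b c d) (fun s => frame_N (chi a b c d) (xi a b c d s)) (frame_B a b c d).
Proof.
  intros H HD.
  assert (P := rho_pos a c H); assert (E := rho_sqr a c); assert (Q := sqrt_lt_R0 _ P).
  assert (Hch : chi a b c d <> 0).
  { intros Z; assert (Y := sqrt_rho_mul_chi a b c d H); rewrite Z, Rmult_0_r in Y.
    apply HD; unfold Delta_abcd.
    transitivity (- ((b * c - a * d) / rho a c) * rho a c); [field; lra | rewrite <- Y; ring]. }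
  apply frenet_frame_coord; split.
  - intros s; apply positive_orthonormal_turn; [|apply frame_orthonormal].
    transitivity ((a ^ 2 + c ^ 2) / rho a c ^ 2); [field; lra | rewrite E; field; lra].
  - set (ch := chi a b c d) in *.
    (* The three coordinates are handled at once through an abstract linear functional compatible
       with derivatives. *)
    assert (K : forall h : R3 -> R, (forall x y, h (plus x y) = h x + h y) ->
      (forall k x, h (scal k x) = k * h x) -> (forall x, h (opp x) = - h x) ->
      (forall f x l, is_derive f x l -> is_derive (fun t => h (f t)) x (h l)) ->
      frenet_coord (fun s => c * s + d) (fun s => a * s + b)
        (fun s => h (frame_T a b c d s)) (fun s => h (frame_N ch (xi a b c d s)))
        (fun s => h (frame_B a b c d s)) /\
      forall s, is_derive (fun s => h (clothoid_curve a b c d s)) s (h (frame_T a b c d s))).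
    { intros h hp hs ho hd; split.
      - assert (FA : forall x, is_derive (fun x => h (frame_A ch x)) x (- ch * h (frame_N ch x)))
          by (intros x; rewrite <- hs; apply hd, is_derive_frame_A).
        assert (FN : forall x, is_derive (fun x => h (frame_N ch x)) x
          (ch * h (frame_A ch x) + x * h (frame_C ch x)))
          by (intros x; rewrite <- !hs, <- hp; apply hd, is_derive_frame_N).
        assert (FC : forall x, is_derive (fun x => h (frame_C ch x)) x (- x * h (frame_N ch x)))
          by (intros x; rewrite <- hs; apply hd, is_derive_frame_C).
        assert (F := frenet_coord_of_darboux a b c d _ _ _ H FA FN FC).
        intros s; destruct (F s) as [F1 [F2 F3]].
        unfold frame_T, frame_B, turn_fst, turn_snd; fold ch.
        split; [|split].
        + eapply is_derive_ext; [|exact F1]; intros t; cbv beta; now rewrite hp, !hs.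
        + rewrite !hp, !hs; exact F2.
        + eapply is_derive_ext; [|exact F3]; intros t; cbv beta; now rewrite hp, !hs.
      - intros s.
        set (p := fun x => (Re (curve_xy a c ch x), Im (curve_xy a c ch x), curve_z a c ch x) : R3).
        assert (D := is_derive_xi a b c d _ _ s
          (hd _ _ _ (is_derive_curve a c ch (xi a b c d s) Hch))).
        change (is_derive (fun s => h (p (xi a b c d s))) s
          (sqrt (rho a c) * h (plus (scal a (frame_A ch (xi a b c d s)))
            (scal (- c) (frame_C ch (xi a b c d s)))))) in D.
        apply (is_derive_ext (fun s => Rpower (rho a c) (- (3 / 2)) *
          (h (p (xi a b c d s)) + - h (p (xi a b c d 0))))).
        { intros t; unfold clothoid_curve; fold ch; fold p.
          rewrite hs; unfold minus; rewrite hp.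
          f_equal; f_equal; symmetry; apply ho. }
        evar_last.
        { apply (is_derive_scal (fun s => h (p (xi a b c d s)) + - h (p (xi a b c d 0)))).
          exact (is_derive_plus _ _ _ _ _ D (is_derive_const _ _)). }
        unfold frame_T, turn_fst; fold ch.
        (* The product of rho^(-3/2) with the chain-rule factor sqrt(rho) is 1/rho, which normalises
           a A - c C to the unit tangent. *)
        rewrite !hp, !hs, Rpower_Ropp, Rpower_three_halves by exact P.
        unfold plus, zero; simpl; field; lra. }
    intros h [-> | [-> | ->]]; (apply K; [reflexivity | reflexivity | reflexivity |]);
      intros f x l D; apply is_derive_R3 in D; tauto.
Qed.

(** The triples (0,0,1), (0,1,0), (-1,0,0) are A, N, C at xi = 0. As A lies on the third axis and C
    on the negative first one, the weights [al] and [be] trade places between the rotation and the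
    vectors it acts on. *)
Lemma rotation_turn (al be : R) (x n y : R3) :
  al ^ 2 + be ^ 2 = 1 ->
  let rot := rotation (turn_fst al be x y) n (turn_snd al be x y) in
  rot (turn_fst be al (0, 0, 1) (-1, 0, 0)) = x /\
  rot (0, 1, 0) = n /\
  rot (turn_snd be al (0, 0, 1) (-1, 0, 0)) = y.
Proof.
  intros E rot; unfold rot, rotation, turn_fst, turn_snd.
  assert (K : forall t1 t2 : R, t1 = (al ^ 2 + be ^ 2) * t2 -> t1 = t2)
    by (intros t1 t2 ->; rewrite E; ring).
  split; [|split]; apply R3_eq; R3_coords; R3_coords;
    unfold px, py, pz; cbn [fst snd]; first [apply K; ring | ring].
Qed.

Lemma clothoid_iff_rigid (a b c d : R) (q : R -> R3) :
  0 < a ^ 2 + c ^ 2 -> Delta_abcd a b c d <> 0 ->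
  clothoid a b c d q <->
  exists g, rigid_motion g /\ forall s, q s = g (clothoid_curve a b c d s).
Proof.
  intros H HD.
  assert (P := rho_pos a c H); assert (E := rho_sqr a c).
  assert (F := clothoid_curve_frame a b c d H HD).
  rewrite clothoid_iff_frame; split.
  - intros [T [N [B Hq]]].
    (* The zero of xi, where the reference frame A, N, C lies along the coordinate axes. *)
    set (s0 := - ((a * b + c * d) / rho a c ^ 2)).
    assert (Hturn : (c / rho a c) ^ 2 + (a / rho a c) ^ 2 = 1).
    { transitivity ((a ^ 2 + c ^ 2) / rho a c ^ 2); [field; lra | rewrite E; field; lra]. }
    (* The columns u, [N s0], w are the vectors -C, N, A of the given clothoid at [s0], the required
       images of the three axes. *)
    set (u := turn_fst (c / rho a c) (a / rho a c) (T s0) (B s0)).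
    set (w := turn_snd (c / rho a c) (a / rho a c) (T s0) (B s0)).
    assert (Ho : positive_orthonormal u (N s0) w)
      by (apply positive_orthonormal_turn; [exact Hturn | apply Hq]).
    set (r0 := clothoid_curve a b c d).
    (* The translation makes the two curves meet at parameter 0. *)
    set (p := minus (q 0) (rotation u (N s0) w (r0 0))).
    exists (fun x => plus p (rotation u (N s0) w x)); split.
    { exists p, u, (N s0), w; split; [exact Ho | reflexivity]. }
    assert (Hx : xi a b c d s0 = 0) by (unfold xi, s0; ring).
    destruct (frame_0 (chi a b c d)) as [A0 [N0 C0]].
    destruct (rotation_turn _ _ (T s0) (N s0) (B s0) Hturn) as [RT [RN RB]].
    apply (frenet_frame_unique _ _ _ _ _ _ _ _ _ _ s0 0 Hq
      (frenet_frame_rigid _ _ _ _ _ _ _ p _ _ _ Ho F (fun s => eq_refl)));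
      cbv beta; unfold frame_T, frame_B; rewrite ?Hx, ?A0, ?N0, ?C0.
    + symmetry; exact RT.
    + symmetry; exact RN.
    + symmetry; exact RB.
    + fold r0; set (X := rotation u (N s0) w (r0 0)) in p |- *; apply R3_eq.
      * change (px (q 0) = px (q 0) + - px X + px X); ring.
      * change (py (q 0) = py (q 0) + - py X + py X); ring.
      * change (pz (q 0) = pz (q 0) + - pz X + pz X); ring.
  - intros [g [[p [u [v [w [Ho Hg]]]]] Hq]].
    do 3 eexists; apply (frenet_frame_rigid _ _ _ _ _ _ q p u v w Ho F).
    intros s; rewrite Hq; apply Hg.
Qed.

Open Scope C_scope.

Theorem theorem1 :
  forall a b c d : R,
    (0 < a ^ 2 + c ^ 2)%R ->
    Delta_abcd a b c d <> 0%R ->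
    let ch : R := chi a b c d in
    let xi0 : R := xi a b c d 0 in
    let rho32 : R := Rpower (rho a c) (- (3 / 2)) in
    let W : R -> C := fun x : R =>
      (2 * c * x * calF ch x
       + Cexp (- zeta x)
         * (a * ch * U ch x ^ 2
            + a * ch ^ 3 * x ^ 2 / 4 * V ch x ^ 2
            - (c * x + Ci * a * ch * x ^ 2) * (U ch x * V ch x)))%C in
    let Z : R -> R := fun x : R =>
      (Re (Ci * c * ch * x ^ 2 / 2 * calG ch x)%C
       + a * x * (2 * Cmod (U ch x) ^ 2 - 1
                  - ch ^ 2 * Im (Cconj (U ch x) * V ch x)%C))%R in
    let xy : R -> C := fun s : R => (rho32 * (W (xi a b c d s) - W xi0))%C in
    let z : R -> R := fun s : R => (rho32 * (Z (xi a b c d s) - Z xi0))%R in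
    let r : R -> R3 := fun s : R => (Re (xy s), Im (xy s), z s) in
    forall q : R -> R3,
      clothoid a b c d q <->
      exists g : R3 -> R3, rigid_motion g /\ forall s : R, q s = g (r s).
Proof.
  intros a b c d H HD ch xi0 rho32 W Z xy z r q.
  assert (Hr : forall s, r s = clothoid_curve a b c d s).
  { intros s; unfold r, xy, z, clothoid_curve.
    apply R3_eq_tuple; [rewrite re_scal_l | rewrite im_scal_l |]; reflexivity. }
  rewrite (clothoid_iff_rigid a b c d q H HD).
  split; intros [g [Hg E]]; exists g; (split; [exact Hg|]); intros s; rewrite E.
  - now rewrite Hr.
  - now rewrite Hr.
Qed.
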